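(* Let $\Omega\subset\mathbb R^2$ be a bounded rational convex polygon and let $P=\{p_1,\dots,p_N\}\subset\Omega^\circ$, $N\ge1$, be a strongly generic configuration. Let $G_0$ be the finite uncut plane multigraph obtained from $\Gamma_P$ by a sufficiently small regular inward truncation, let $e_i$ be the edge of $G_0$ containing $p_i$, and let $G_0^\vee$ be the planar dual multigraph of $G_0$. Then the dual edges $$e_1^\vee,\dots,e_N^\vee$$ form a spanning tree of $G_0^\vee$.
   Context: A bounded rational convex polygon is a compact convex polygon $\Omega\subset\mathbb R^2$ with nonempty interior $\Omega^\circ$, of the form $\Omega=\bigcap_{r=1}^s\{x:\langle n_r,x\rangle+a_r\ge0\}$ with primitive $n_r\in\mathbb Z^2$, $a_r\in\mathbb R$. An $\Omega$-tropical series is a continuous function $F:\Omega\to\mathbb R_{\ge0}$ with $F=0$ on $\partial\Omega$ which near every point of $\Omega^\circ$ has the form $F(x)=\min_{m\in A}(c_m+\langle m,x\rangle)$ with $A\subset\mathbb Z^2$ finite and $c_m\in\mathbb R$; it is concave. Its corner locus $V(F)\subset\Omega^\circ$ is the set of points where the minimum is attained by at least two distinct affine functions. For nonempty finite $P\subset\Omega^\circ$, the tropical relaxation $F_P=G_P0_\Omega$ is the pointwise infimum of all $\Omega$-tropical series $G$ with $P\subset V(G)$; it is itself such a series. Put $\Gamma_P=V(F_P)$. The linearity cells of $F_P$ are the closures of the maximal connected open subsets of $\Omega^\circ$ on which $F_P$ is affine; each has a gradient in $\mathbb Z^2$. $\Gamma_P$ is a finite embedded polyhedral graph, whose vertices (tropical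 vertices) are the points $v\in\Omega^\circ$ whose superdifferential $\{p:F_P(y)\le F_P(v)+\langle p,y-v\rangle\ \forall y\in\Omega\}$ is two-dimensional (so transverse crossings are four-valent vertices) and whose edges are the straight segments into which the vertices divide it; an edge separating cells of gradients $m_0,m_1$ has weight $w\ge1$ where $m_1-m_0=wn$ with $n\in\mathbb Z^2$ primitive. The gradient-labelled marked type of $P=(p_1,\dots,p_N)$ consists of the embedded face poset of this subdivision of $\Omega$ (cells, edges, vertices, incidences, cyclic orders), the gradient of each two-dimensional cell, all edge weights, all incidences with the sides and vertices of $\Omega$, and for each $i$ the face containing $p_i$ in its relative interior. $P$ (a set of $N$ distinct points of $\Omega^\circ$) is strongly generic if (i) every $p_i$ lies in the relative interior of an edge of $\Gamma_P$; (ii) distinct $p_i$ lie on distinct edges; (iii) the gradient-labelled marked type is unchanged under all sufficiently small independent perturbations of the points $p_i$. Regular inward truncation. Choose a polygonal region $\Omega'$ with $\overline{\Omega'}\subset\Omega^\circ$, close to $\Omega$, that contains every marked point and every tropical vertex, has no marked point or tropical vertex on its boundary, and whose boundary crosses each edge of $\Gamma_P$ that leaves $\overline{\Omega'}$ transversely exactly once. $G_0$ is the finite plane multigraph with support $\Gamma_P\cap\overline{\Omega'}$ whose vertices are the tropical vertices (including transverse nodes, as four-valent vertices) and, as degree-one vertices, the crossings with $\partial\Omega'$; all other degree-two points, including the marked points, are suppressed as vertices, but the $p_i$ remain distinguished points. There is a unique edge $e_i$ of $G_0$ with $p_i$ in its relative interior. The planar dual $G_0^\vee$ has one vertex for each face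 of $G_0$ (including the unbounded face), and one edge $e^\vee$ for each edge $e$ of $G_0$, joining the faces on the two sides of $e$ (a loop if they coincide; parallel edges allowed). *)

(* Defs.v *)
From mathcomp Require Export all_boot all_order all_algebra.
From mathcomp Require Export all_classical all_reals all_analysis.
Import Order.TTheory GRing.Theory Num.Theory numFieldNormedType.Exports.

Set Implicit Arguments.
Unset Strict Implicit.
Unset Printing Implicit Defensive.

Local Open Scope classical_set_scope.
Local Open Scope ring_scope.

(* The plane carries the product (sup-norm) topology and normed structure; the
   norm is only used to express smallness. *)
Notation plane R := (R * R)%type.
Notation lattice := (int * int)%type.

Definition dot {R : realType} (x y : plane R) : R := x.1 * y.1 + x.2 * y.2.

Definition det2 {R : realType} (x y : plane R) : R := x.1 * y.2 - x.2 * y.1.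

Definition rot90 {R : realType} (x : plane R) : plane R := (- x.2, x.1).

Definition lat {R : realType} (m : lattice) : plane R := (m.1%:~R, m.2%:~R).

Definition primitive (m : lattice) : bool := coprimez m.1 m.2.

Definition open_seg {R : realType} (a b : plane R) : set (plane R) :=
  [set a + t *: (b - a) | t in [set t : R | 0 < t < 1]].

Definition closed_seg {R : realType} (a b : plane R) : set (plane R) :=
  [set a + t *: (b - a) | t in [set t : R | 0 <= t <= 1]].

Definition half_open_seg {R : realType} (a b : plane R) : set (plane R) :=
  [set a + t *: (b - a) | t in [set t : R | 0 <= t < 1]].

Definition bd {R : realType} (A : set (plane R)) : set (plane R) :=
  closure A `\` A°.

(** * Rational polygons and tropical series *)

Definition rational_polygon {R : realType} (Omega : set (plane R)) : Prop :=
  [/\ exists (s : nat) (n : 'I_s -> lattice) (a : 'I_s -> R),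
        (forall r, primitive (n r)) /\
        Omega = [set x | forall r, 0 <= dot (lat (n r)) x + a r],
      compact Omega & Omega° !=set0].

Definition polygon_side {R : realType} (Omega S : set (plane R)) : Prop :=
  exists (n : plane R) (a : R),
    [/\ n != 0,
        Omega `<=` [set x | 0 <= dot n x + a],
        S = Omega `&` [set x | dot n x + a = 0] &
        exists x y, [/\ S x, S y & x != y]].

Definition polygon_vertex {R : realType} (Omega : set (plane R))
    (w : plane R) : Prop :=
  Omega w /\
  forall x y, Omega x -> Omega y -> open_seg x y w -> x = y.

(* Near x, F is the minimum of the c m + <m, .> for m in A. *)
Definition local_min_form {R : realType} (F : plane R -> R) (x : plane R)
    (A : seq lattice) (c : lattice -> R) : Prop :=
  \forall y \near x,
    (forall m, m \in A -> F y <= c m + dot (lat m) y) /\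
    (exists2 m, m \in A & F y = c m + dot (lat m) y).

(* Only the values on Omega are meaningful. *)
Definition tropical_series {R : realType} (Omega : set (plane R))
    (F : plane R -> R) : Prop :=
  [/\ {within Omega, continuous F},
      (forall x, Omega x -> 0 <= F x),
      (forall x, bd Omega x -> F x = 0) &
      forall x, Omega° x -> exists A c, local_min_form F x A c].

Definition corner_locus {R : realType} (Omega : set (plane R))
    (F : plane R -> R) : set (plane R) :=
  [set x | Omega° x /\
    exists A c, local_min_form F x A c /\
      exists m m' : lattice,
        [/\ m \in A, m' \in A, m != m',
            F x = c m + dot (lat m) x & F x = c m' + dot (lat m') x]].

Definition relaxation {R : realType} (Omega P : set (plane R))
    (x : plane R) : R :=
  inf [set G x | G in [set G : plane R -> R |
         tropical_series Omega G /\ P `<=` corner_locus Omega G]].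

(** * Plane graphs, multigraphs and duals *)

(* A plane graph is given by its support and its vertices; its edges are the
   relatively open segments into which the vertices divide the support. *)
Record plane_graph (R : realType) := PlaneGraph {
  support : set (plane R);
  nodes : set (plane R) }.

Definition edge_through {R : realType} (G : plane_graph R) (x : plane R) :
    set (plane R) :=
  connected_component (support G `\` nodes G) x.

Definition graph_edge {R : realType} (G : plane_graph R)
    (e : set (plane R)) : Prop :=
  (exists2 x, (support G `\` nodes G) x & e = edge_through G x) /\
  (exists a b, a != b /\ e = open_seg a b).

Definition graph_face {R : realType} (G : plane_graph R)
    (f : set (plane R)) : Prop :=
  exists2 x, ~ support G x & f = connected_component (~` support G) x.

(* mg_ends e u v means that e joins u and v; u = v is allowed (a loop), and so
   are distinct edges with the same ends. *)
Record multigraph (V E : Type) := Multigraph {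
  mg_vertex : set V;
  mg_edge : set E;
  mg_ends : E -> V -> V -> Prop }.

(* f lies on the left and g on the right of e directed from a to b; the choice
   of a and b makes the relation symmetric in f and g. *)
Definition face_sides {R : realType} (G : plane_graph R)
    (e f g : set (plane R)) : Prop :=
  [/\ graph_edge G e, graph_face G f, graph_face G g &
      exists a b, [/\ a != b, e = open_seg a b &
        forall x, e x -> \forall t \near (0 : R)^'+,
          f (x + t *: rot90 (b - a)) /\ g (x - t *: rot90 (b - a))]].

(* The dual edge of e is represented by e itself. *)
Definition planar_dual {R : realType} (G : plane_graph R) :
    multigraph (set (plane R)) (set (plane R)) :=
  Multigraph (graph_face G) (graph_edge G) (face_sides G).

Definition mg_walk {V E : Type} (G : multigraph V E) (T : set E)
    (u w : V) : Prop :=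
  exists (n : nat) (v : nat -> V) (e : nat -> E),
    [/\ v 0%N = u, v n = w &
        forall i, (i < n)%N -> T (e i) /\ mg_ends G (e i) (v i) (v i.+1)].

(* A cycle of length n >= 1: a loop for n = 1, two parallel edges for n = 2. *)
Definition mg_cycle {V E : Type} (G : multigraph V E) (T : set E)
    (n : nat) (v : nat -> V) (e : nat -> E) : Prop :=
  [/\ (0 < n)%N,
      {in [pred i | (i < n)%N] &, injective v},
      {in [pred i | (i < n)%N] &, injective e} &
      forall i, (i < n)%N ->
        T (e i) /\ mg_ends G (e i) (v i) (v (i.+1 %% n)%N)].

Definition spanning_tree {V E : Type} (G : multigraph V E) (T : set E) : Prop :=
  [/\ T `<=` mg_edge G,
      mg_vertex G !=set0,
      (forall u w, mg_vertex G u -> mg_vertex G w -> mg_walk G T u w) &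
      forall n v e, ~ mg_cycle G T n v e].

(** * The subdivision of Omega defined by a tropical series *)

Definition superdifferential {R : realType} (Omega : set (plane R))
    (F : plane R -> R) (v : plane R) : set (plane R) :=
  [set q | forall y, Omega y -> F y <= F v + dot q (y - v)].

(* The affine hull of S is the whole plane. *)
Definition two_dimensional {R : realType} (S : set (plane R)) : Prop :=
  exists a b c, [/\ S a, S b, S c & det2 (b - a) (c - a) != 0].

Definition tropical_vertex {R : realType} (Omega : set (plane R))
    (F : plane R -> R) : set (plane R) :=
  [set v | Omega° v /\ two_dimensional (superdifferential Omega F v)].

Definition tropical_graph {R : realType} (Omega : set (plane R))
    (F : plane R -> R) : plane_graph R :=
  PlaneGraph (corner_locus Omega F) (tropical_vertex Omega F).

Definition linearity_domain {R : realType} (Omega : set (plane R))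
    (F : plane R -> R) (U : set (plane R)) : Prop :=
  [/\ open U, connected U, U !=set0, U `<=` Omega° &
      exists (q : plane R) (c : R), forall x, U x -> F x = c + dot q x].

(* The faces of the subdivision are represented by their relative interiors:
   maximal linearity domains, open edges, singletons of vertices.  The
   linearity cells, closed edges and vertices are the closures of these. *)
Definition face_cell {R : realType} (Omega : set (plane R))
    (F : plane R -> R) (U : set (plane R)) : Prop :=
  linearity_domain Omega F U /\
  forall U', linearity_domain Omega F U' -> U `<=` U' -> U' = U.

Definition face_edge {R : realType} (Omega : set (plane R))
    (F : plane R -> R) (e : set (plane R)) : Prop :=
  graph_edge (tropical_graph Omega F) e.

Definition face_vertex {R : realType} (Omega : set (plane R))
    (F : plane R -> R) (f : set (plane R)) : Prop :=
  exists2 v, tropical_vertex Omega F v & f = [set v].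

Definition face {R : realType} (Omega : set (plane R)) (F : plane R -> R) :
    set (set (plane R)) :=
  face_cell Omega F `|` face_edge Omega F `|` face_vertex Omega F.

Definition has_gradient {R : realType} (F : plane R -> R)
    (U : set (plane R)) (m : lattice) : Prop :=
  exists c : R, forall x, U x -> F x = c + dot (lat m) x.

Definition has_weight {R : realType} (Omega : set (plane R))
    (F : plane R -> R) (e : set (plane R)) (w : nat) : Prop :=
  (0 < w)%N /\
  exists U0 U1 (m0 m1 n : lattice),
    [/\ face_cell Omega F U0 /\ face_cell Omega F U1,
        U0 <> U1,
        e `<=` closure U0 /\ e `<=` closure U1,
        has_gradient F U0 m0 /\ has_gradient F U1 m1 &
        primitive n /\ m1 - m0 = n *+ w].

Definition face_le {R : realType} (f g : set (plane R)) : Prop :=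
  closure f `<=` closure g.

Definition incident {R : realType} (f g : set (plane R)) : Prop :=
  f <> g /\ (face_le f g \/ face_le g f).

(* The directions of d1, d2, d3 are distinct and in counterclockwise cyclic
   order: at most one of the three successive angles is >= pi. *)
Definition ccw {R : realType} (d1 d2 d3 : plane R) : Prop :=
  [\/ 0 < det2 d1 d2 /\ 0 < det2 d2 d3,
      0 < det2 d2 d3 /\ 0 < det2 d3 d1 |
      0 < det2 d3 d1 /\ 0 < det2 d1 d2].

(* Counterclockwise cyclic order of distinct faces g1, g2, g3 incident to a face
   f, as seen from f: edges and cells around a vertex, edges and vertices along
   the boundary of a cell, cells and end vertices around an edge.  All faces
   being convex, the choice of the points does not matter. *)
Definition cyclic_around {R : realType} (f g1 g2 g3 : set (plane R)) : Prop :=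
  exists x y1 y2 y3,
    [/\ f x, g1 y1, g2 y2, g3 y3 & ccw (y1 - x) (y2 - x) (y3 - x)].

(** * Gradient-labelled marked types and strong genericity *)

Definition same_face_poset {R : realType} (Omega : set (plane R))
    (F F' : plane R -> R) (phi : set (plane R) -> set (plane R)) : Prop :=
  [/\ set_bij (face Omega F) (face Omega F') phi,
      (forall f, face Omega F f ->
        [/\ face_cell Omega F f <-> face_cell Omega F' (phi f),
            face_edge Omega F f <-> face_edge Omega F' (phi f) &
            face_vertex Omega F f <-> face_vertex Omega F' (phi f)]),
      (forall f g, face Omega F f -> face Omega F g ->
        face_le f g <-> face_le (phi f) (phi g)) &
      (forall f g1 g2 g3,
        [/\ face Omega F f, face Omega F g1, face Omega F g2 &
            face Omega F g3] ->
        [/\ incident f g1, incident f g2 & incident f g3] ->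
        [/\ g1 <> g2, g2 <> g3 & g3 <> g1] ->
        cyclic_around f g1 g2 g3 <->
        cyclic_around (phi f) (phi g1) (phi g2) (phi g3))].

(* Besides incidence, it is recorded whether a face meets a side of Omega in
   more than one point. *)
Definition same_boundary_incidences {R : realType} (Omega : set (plane R))
    (F : plane R -> R) (phi : set (plane R) -> set (plane R)) : Prop :=
  forall f, face Omega F f ->
    [/\ (forall S, polygon_side Omega S ->
          (closure f `&` S !=set0) <-> (closure (phi f) `&` S !=set0)),
        (forall S, polygon_side Omega S ->
          is_subset1 (closure f `&` S) <->
          is_subset1 (closure (phi f) `&` S)) &
        (forall w, polygon_vertex Omega w ->
          closure f w <-> closure (phi f) w)].

Definition same_marked_type {R : realType} (Omega : set (plane R)) (N : nat)
    (p p' : 'I_N -> plane R) : Prop :=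
  let F := relaxation Omega (range p) in
  let F' := relaxation Omega (range p') in
  exists phi : set (plane R) -> set (plane R),
    [/\ same_face_poset Omega F F' phi,
        (forall U m, face_cell Omega F U ->
          has_gradient F U m <-> has_gradient F' (phi U) m),
        (forall e w, face_edge Omega F e ->
          has_weight Omega F e w <-> has_weight Omega F' (phi e) w),
        same_boundary_incidences Omega F phi &
        (forall i f, face Omega F f -> f (p i) <-> phi f (p' i))].

Definition strongly_generic {R : realType} (Omega : set (plane R)) (N : nat)
    (p : 'I_N -> plane R) : Prop :=
  let F := relaxation Omega (range p) in
  [/\ injective p /\ (forall i, Omega° (p i)),
      (forall i, exists2 e, face_edge Omega F e & e (p i)),
      (forall i j e, face_edge Omega F e -> e (p i) -> e (p j) -> i = j) &
      exists2 eps : R, 0 < eps &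
        forall p' : 'I_N -> plane R,
          (forall i, `|p' i - p i| < eps) -> same_marked_type Omega p p'].

(** * Regular inward truncation *)

(* q lists the successive vertices of a simple closed polygon. *)
Definition simple_polygon {R : realType} (k : nat) (q : 'I_k -> plane R) :
    Prop :=
  [/\ (2 < k)%N, injective q &
      forall i j x, half_open_seg (q i) (q (ordS i)) x ->
        half_open_seg (q j) (q (ordS j)) x -> i = j].

(* W is the interior of the simple closed polygon q. *)
Definition polygonal_region {R : realType} (k : nat) (q : 'I_k -> plane R)
    (W : set (plane R)) : Prop :=
  [/\ simple_polygon q, open W, connected W, bounded_set W &
      W !=set0 /\ bd W = \bigcup_i closed_seg (q i) (q (ordS i))].

(* The edge e meets the boundary of the region bounded by q exactly once, inside
   a side of q and not parallel to it. *)
Definition crosses_once {R : realType} (k : nat) (q : 'I_k -> plane R)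
    (W e : set (plane R)) : Prop :=
  exists x i a b,
    [/\ e `&` bd W = [set x], open_seg (q i) (q (ordS i)) x,
        e = open_seg a b & det2 (b - a) (q (ordS i) - q i) != 0].

Definition leaving_edge {R : realType} (G : plane_graph R)
    (W e : set (plane R)) : Prop :=
  graph_edge G e /\ ~ (e `<=` closure W).

(* eps measures how close W is to Omega.  As W is open, no marked point and no
   vertex lies on its boundary. *)
Definition regular_truncation {R : realType} (Omega : set (plane R)) (N : nat)
    (p : 'I_N -> plane R) (eps : R) (W : set (plane R)) : Prop :=
  let G := tropical_graph Omega (relaxation Omega (range p)) in
  exists (k : nat) (q : 'I_k -> plane R),
    [/\ polygonal_region q W,
        closure W `<=` Omega°,
        (forall x, Omega x -> exists2 y, W y & `|x - y| < eps),
        range p `<=` W /\ nodes G `<=` W &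
        forall e, leaving_edge G W e -> crosses_once q W e].

Definition truncated_graph {R : realType} (G : plane_graph R)
    (W : set (plane R)) : plane_graph R :=
  PlaneGraph (support G `&` closure W)
    (nodes G `|` [set x | bd W x /\ exists2 e, leaving_edge G W e & e x]).

(* Main.v *)
(* Write F for the relaxation.  Its affine pieces are indexed by their gradients:
   the constant term of the piece of gradient m is upper_const F m, the least c
   such that F <= c + <m, .> on Omega.  A face of G_0 is either a linearity cell
   whose closure avoids the boundary of Omega, or the exterior face, into which
   all other cells merge.

   No cycle: a marked point on an edge between the pieces m and k gives the
   equation upper_const F m - upper_const F k = <k - m, p_i>, and the constant
   of a piece reaching the boundary depends on m only, because F vanishes there.
   Along a cycle of dual edges the left-hand sides cancel, but moving a single
   p_i, which preserves cells and gradients by genericity, moves exactly one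
   right-hand side.

   Connectedness: if some cells cannot be reached from the exterior through
   marked edges, lowering all their constants by the same small amount gives a
   smaller tropical series that still has every p_i on its corner locus. *)

(* A tropical series is only locally a minimum of finitely many affine functions, and its pieces
   might a priori accumulate at the boundary of [Omega]. The proof therefore works without a finite
   global list of pieces: [tropical_support] turns a local touching inequality into a global one, so
   each gradient has a single constant [upper_const F m], and finiteness enters only near an
   interior point or over the marked points. Accordingly the constants actually lowered are finitely
   many: those of one unreachable cell and of the unreachable cells beside marked points. Edges are
   handled through the local condition [germ m k]; the points satisfying it form a convex set, which
   is exactly one edge. Since an edge crosses the boundary of [W] at most once, a part outside [W]
   runs to the boundary of [Omega]; hence the frontier of a cell away from that boundary survives
   the truncation. That the relaxation is a tropical series has to be proved. Its class of
   competitors is nonempty because the infimum over an empty class is 0, and the zero function has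
   no corner to carry a marked point. *)
Require Import Defs.
From mathcomp Require Import ring lra zify.
Import Order.TTheory GRing.Theory Num.Theory numFieldNormedType.Exports.
Set Implicit Arguments.
Unset Strict Implicit.
Unset Printing Implicit Defensive.
Local Open Scope classical_set_scope.
Local Open Scope ring_scope.

(** * Planar geometry *)

Section Plane.
Context {R : realType}.
Implicit Types (x y z u v w n q : plane R) (m k : lattice) (A B W : set (plane R)).

Lemma plane_eq x y : x.1 = y.1 -> x.2 = y.2 -> x = y.
Proof. by case: x y => [? ?] [? ?] /= -> ->. Qed.

Lemma dotDr q x y : dot q (x + y) = dot q x + dot q y.
Proof. by rewrite /dot /=; ring. Qed.

Lemma dotNr q x : dot q (- x) = - dot q x.
Proof. by rewrite /dot /=; ring. Qed.

Lemma dotBr q x y : dot q (x - y) = dot q x - dot q y.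
Proof. by rewrite dotDr dotNr. Qed.

Lemma dotZr q (t : R) x : dot q (t *: x) = t * dot q x.
Proof. by rewrite /dot /= /GRing.scale /=; ring. Qed.

Lemma dotNl q x : dot (- q) x = - dot q x.
Proof. by rewrite /dot /=; ring. Qed.

Lemma dotBl q q' x : dot (q - q') x = dot q x - dot q' x.
Proof. by rewrite /dot /=; ring. Qed.

Lemma dotC x y : dot x y = dot y x.
Proof. by rewrite /dot mulrC [X in _ + X]mulrC. Qed.

Lemma latB m k : lat (m - k) = lat m - lat k :> plane R.
Proof. by rewrite /lat /= !intrB. Qed.

Lemma dot_gt0 q : q != 0 -> 0 < dot q q.
Proof.
case: q => a b; rewrite /dot /= => ab0.
have : (a != 0) || (b != 0) by rewrite -negb_and.
by case/orP => h; [apply: ltr_wpDr|apply: ltr_wpDl];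
  rewrite -?expr2 ?sqr_ge0 // exprn_even_gt0.
Qed.

Lemma lat_eq0 m : (lat m == 0 :> plane R) = (m == 0).
Proof. by case: m => a b; rewrite /lat /= !xpair_eqE /= !intr_eq0. Qed.

Lemma lat_inj : injective (@lat R).
Proof.
by move=> m k h; apply/eqP; rewrite -subr_eq0 -lat_eq0 latB h subrr.
Qed.

(** Both [u] and [v] are multiples of [n], so [u - v] is determined by its product with [n]; the
    division by [dot n n] is cleared. *)
Lemma collinear_dot n u v w : det2 n u = 0 -> det2 n v = 0 ->
  dot n n * dot (u - v) w = (dot n u - dot n v) * dot n w.
Proof.
case: n u v w => [n1 n2] [u1 u2] [v1 v2] [w1 w2]; rewrite /det2 /dot /= => hu hv.
apply/eqP; rewrite -subr_eq0; apply/eqP.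
transitivity ((n1 * u2 - n2 * u1 - (n1 * v2 - n2 * v1)) * (n1 * w2 - n2 * w1));
  first by ring.
by rewrite hu hv subrr mul0r.
Qed.

Lemma dot_rot90 n : dot n (rot90 n) = 0.
Proof. by rewrite /dot /rot90 /=; ring. Qed.

Lemma rot90_eq0 n : (rot90 n == 0) = (n == 0).
Proof. by case: n => a b; rewrite /rot90 /= !xpair_eqE oppr_eq0 andbC. Qed.

Lemma dot0_rot90 n w : n != 0 -> dot n w = 0 ->
  w = (dot (rot90 n) w / dot n n) *: rot90 n.
Proof.
move=> /dot_gt0; case: n w => [a b] [c d]; rewrite /dot /rot90 /= => n0 h.
apply: plane_eq; rewrite /= /GRing.scale /=.
  transitivity ((a * (a * c + b * d) - b * (- b * c + a * d)) /
    (a * a + b * b)); last first.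
    by rewrite h; field; rewrite gt_eqF.
  by field; rewrite gt_eqF.
transitivity ((b * (a * c + b * d) + a * (- b * c + a * d)) / (a * a + b * b));
  last first.
  by rewrite h; field; rewrite gt_eqF.
by field; rewrite gt_eqF.
Qed.

Lemma det2_dot0 n u v : n != 0 -> dot n u = 0 -> dot n v = 0 -> det2 u v = 0.
Proof.
move=> n0 /(dot0_rot90 n0) -> /(dot0_rot90 n0) ->.
by rewrite /det2 /= /GRing.scale /=; ring.
Qed.

Lemma dot_rot90_neq0 n w : n != 0 -> w != 0 -> dot n w = 0 -> dot n (rot90 w) != 0.
Proof.
move=> n0 w0 h; apply: contraNneq w0 => h'.
have := det2_dot0 n0 h h'; apply: contra_eqT => /dot_gt0 w0.
by move: w0; rewrite /dot /det2 /rot90 /= mulrN opprK => /gt_eqF ->.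
Qed.

Lemma dot_continuous q : continuous (dot q).
Proof.
move=> x; rewrite /dot; apply: cvgD; apply: cvgM; try exact: cvg_cst.
  exact: cvg_fst.
exact: cvg_snd.
Qed.

Lemma affine_continuous (c : R) q : continuous (fun x => c + dot q x).
Proof. by move=> x; apply: cvgD; [exact: cvg_cst|exact: dot_continuous]. Qed.

Lemma near_affine_gt0 (c : R) q x : 0 < c + dot q x ->
  \forall y \near x, 0 < c + dot q y.
Proof. by move=> h; exact:
  (cvgr_gt (c + dot q x) (@affine_continuous c q x) _ h). Qed.

Lemma line_continuous x v : continuous (fun t : R => x + t *: v).
Proof.
move=> t; apply: cvgD; first exact: cvg_cst.
by apply: cvgZr_tmp.
Qed.

Lemma near_line x v A : nbhs x A -> \forall t \near (0 : R), A (x + t *: v).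
Proof.
move=> xA; have := @line_continuous x v 0; rewrite /continuous_at scale0r addr0.
exact.
Qed.

Lemma near_line_sym x v A (b : R) : nbhs x A -> 0 < b ->
  exists r : R, [/\ 0 < r, r < b, A (x + r *: v) & A (x + (- r) *: v)].
Proof.
move=> /(near_line v) h b0.
have hN : \forall t \near (0 : R), A (x + (- t) *: v).
  by move: h; rewrite -{1}oppr0 nearN.
have : \forall t \near (0 : R)^'+,
    [/\ 0 < t, t < b, A (x + t *: v) & A (x + (- t) *: v)].
  have h1 : \forall t \near (0 : R)^'+, t < b by exact: nbhs_right_lt.
  have h2 : \forall t \near (0 : R)^'+, 0 < t by exact: nbhs_right_gt.
  have h3 : \forall t \near (0 : R)^'+, A (x + t *: v) /\ A (x + (- t) *: v).
    by apply: filterS2 h hN => t.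
  by apply: filterS3 h1 h2 h3 => t ? ? [].
by move=> /filter_ex[t []]; exists t.
Qed.

Lemma near_line_gt0 x v A : nbhs x A -> exists2 t : R, 0 < t & A (x + t *: v).
Proof. by move=> /(near_line_sym v)/(_ ltr01)[t [t0 _ At _]]; exists t. Qed.

Lemma near_ball x A : nbhs x A ->
  exists2 r : R, 0 < r & forall w : plane R, `|w| < r -> A (x + w).
Proof.
move=> /nbhs_normP[r /= r0 rA]; exists r => // w wr; apply: rA => /=.
by rewrite opprD addrA subrr sub0r normrN.
Qed.

Lemma ball_near x A (r : R) : 0 < r ->
  (forall w : plane R, `|w| < r -> A (x + w)) ->
  nbhs x A.
Proof.
move=> r0 rA; apply/(@nbhs_normP R (plane R)); exists r => // y /= yr.
by rewrite -(subrK x y) addrC; apply: rA; rewrite distrC.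
Qed.

(** A step from [x] in direction [- q] would make the affine function negative. Uniqueness of the
    gradient of a cell rests on this. *)
Lemma affine_min_cst x q (c : R) :
  (\forall y \near x, 0 <= c + dot q y) -> c + dot q x = 0 -> q = 0.
Proof.
move=> h xz; apply/eqP/negPn/negP => q0.
have [t t0] := near_line_gt0 (- q) h.
rewrite dotDr dotZr dotNr addrA xz add0r mulrN oppr_ge0.
by rewrite leNgt mulr_gt0 // dot_gt0.
Qed.

(** * Convexity and connectedness in the plane *)

Definition convex A := forall x y (t : R), A x -> A y -> 0 <= t <= 1 ->
  A (x + t *: (y - x)).

Lemma segE x y (t : R) : x + t *: (y - x) = (1 - t) *: x + t *: y.
Proof. by rewrite scalerBr scalerBl scale1r addrCA addrC -addrA [- _ + _]addrC. Qed.

Lemma seg_sym x y (t : R) : x + t *: (y - x) = y + (1 - t) *: (x - y).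
Proof. by rewrite !segE opprB addrCA subrr addr0 addrC. Qed.

(** The homothety with centre [x] and ratio [t] sends a ball about [u] to a ball of radius [t * r],
    which convexity keeps inside [A]. *)
Lemma convex_interior_half A x u (t : R) : convex A -> A x -> A° u ->
  0 < t <= 1 -> A° (x + t *: (u - x)).
Proof.
move=> cA Ax /near_ball[r r0 rA] /andP[t0 t1].
apply: (@ball_near _ _ (t * r)); first exact: mulr_gt0.
move=> w wr.
have -> : x + t *: (u - x) + w = x + t *: ((u + t^-1 *: w) - x).
  by apply: plane_eq; rewrite /= /GRing.scale /=; field; rewrite gt_eqF.
apply: cA => //; last by rewrite ltW.
by apply: rA; rewrite normrZ gtr0_norm ?invr_gt0// ltr_pdivrMl.
Qed.

Lemma convex_interior A : convex A -> convex A°.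
Proof.
move=> cA x y t Ax Ay /andP[t0 t1].
have [->|tn0] := eqVneq t 0; first by rewrite scale0r addr0.
by apply: convex_interior_half => //; [exact: interior_subset|rewrite lt0r tn0 t0].
Qed.

Lemma closed_seg_connected x y : connected (closed_seg x y).
Proof.
have -> : closed_seg x y = (fun t : R => x + t *: (y - x)) @` `[0, 1].
  by apply/seteqP; split => z [t /= t01 <-]; exists t => //=; move: t01;
    rewrite in_itv.
apply: connected_continuous_connected; first exact: segment_connected.
by apply: continuous_subspaceT => t; exact: line_continuous.
Qed.

Lemma closed_segl x y : closed_seg x y x.
Proof. by exists 0; rewrite /= ?lexx ?ler01 // scale0r addr0. Qed.

Lemma closed_segr x y : closed_seg x y y.
Proof. by exists 1; rewrite /= ?lexx ?ler01 // scale1r addrC subrK. Qed.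

Lemma connected_pairs A :
  (forall x y, A x -> A y -> exists B, [/\ connected B, B `<=` A, B x & B y]) ->
  connected A.
Proof.
move=> h; have [[x Ax]|A0] := pselect (A !=set0); last first.
  by rewrite (_ : A = set0);
    [exact: connected0|apply/seteqP; split=> // x Ax; apply: A0; exists x].
have -> : A = connected_component A x.
  apply/seteqP; split; last exact: connected_component_sub.
  by move=> y /(h _ _ Ax)[B [cB BA Bx By]];
    apply: (connected_component_max Bx BA cB).
exact: component_connected.
Qed.

Lemma convex_connected A : convex A -> connected A.
Proof.
move=> cA; apply: connected_pairs => x y Ax Ay; exists (closed_seg x y).
by split; [exact: closed_seg_connected|move=> _ [t /= t01 <-]; exact: cA|
  exact: closed_segl|exact: closed_segr].
Qed.

(** If [B] missed the boundary, the trace of [W] on [B] would equal that of [closure W], hence be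
    open and closed in [B]. *)
Lemma connected_meets_bd B W : connected B -> open W ->
  B `&` W !=set0 -> ~ (B `<=` W) -> B `&` bd W !=set0.
Proof.
move=> cB oW BW nBW; apply: contrapT => nbd; apply: nBW.
have <- : B `&` W = B.
  apply: cB => //; first by exists W.
  exists (closure W); first exact: closed_closure.
  apply/seteqP; split => x [Bx Wx]; split => //; first exact: subset_closure.
  apply: contrapT => nWx; apply: nbd; exists x; split => //; split => //.
  by move=> /interior_subset.
exact: subIsetr.
Qed.

Lemma open_bd W x : open W -> bd W x -> closure W x /\ ~ W x.
Proof. by rewrite openE => oW [cx ix]; split => // Wx; apply: ix; exact: oW. Qed.

Lemma open_closure_cases W x : open W -> closure W x -> W x \/ bd W x.
Proof.
by move=> oW cx; have [|nWx] := pselect (W x);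
  [left|right; split => // /interior_subset].
Qed.

End Plane.

Lemma near_seq (R : realType) (x : plane R) (T : eqType) (A : seq T)
    (P : T -> plane R -> Prop) :
  (forall m, m \in A -> \forall y \near x, P m y) ->
  \forall y \near x, forall m, m \in A -> P m y.
Proof.
elim: A => [|a A IH] h; first by apply: filterE => y m; rewrite in_nil.
have h1 : \forall y \near x, P a y by apply: h; rewrite mem_head.
have h2 : \forall y \near x, forall m, m \in A -> P m y.
  by apply: IH => m mA; apply: h; rewrite inE mA orbT.
apply: filterS2 h1 h2 => y Pa PA m; rewrite inE => /orP[/eqP->//|]; exact: PA.
Qed.

Lemma quadratic_continuous (R : realType) (a b d : R) :
  continuous (fun t : R => a + b * t + d * (t * t)).
Proof.
move=> t; apply: cvgD; first apply: cvgD.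
- exact: cvg_cst.
- by apply: cvgM; [exact: cvg_cst|exact: cvg_id].
- by apply: cvgM; [exact: cvg_cst|apply: cvgM; exact: cvg_id].
Qed.

Lemma seq_argmin (R : realType) (T : eqType) (f : T -> R) (A : seq T) a : a \in A ->
  exists2 m, m \in A & forall k, k \in A -> f m <= f k.
Proof.
elim: A a => // b A IH a _; case: A IH => [|c A] IH.
  by exists b; rewrite ?mem_head // => k; rewrite inE => /eqP ->.
have [m mA hm] := IH c (mem_head _ _).
have [le|lt] := leP (f b) (f m).
  exists b; first exact: mem_head.
  by move=> k; rewrite inE => /orP[/eqP->//|/hm]; exact: le_trans.
by exists m; rewrite ?(@in_cons _ b) ?mA ?orbT // => k;
  rewrite inE => /orP[/eqP->|/hm //]; exact: ltW.
Qed.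

(** Serves to recognise an edge, parametrised along its line, as an open segment. The points [t + r]
    and [t - r] only ensure that neither bound is attained; the last hypothesis fills the
    interval. *)
Lemma bounded_open_intervalP (R : realType) (T : set R) (M : R) : T !=set0 ->
  (forall t, T t -> `|t| <= M) ->
  (forall t, T t -> exists r, [/\ 0 < r, T (t + r) & T (t - r)]) ->
  (forall a b t, T a -> T b -> a < t < b -> T t) ->
  exists a b : R, a < b /\ forall t, T t <-> a < t < b.
Proof.
move=> T0 bT oT cT.
have uT : has_ubound T by exists M => t /bT; exact: le_trans (ler_norm _).
have lT : has_lbound T.
  by exists (- M) => t /bT; rewrite ler_norml => /andP[].
have TE t : T t <-> inf T < t < sup T.
  split=> [Tt|/andP[/(inf_lt T0)[a Ta at'] /(sup_gt T0)[b Tb tb]]]; last first.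
    by apply: cT Ta Tb _; rewrite at' tb.
  have [r [r0 Tr TNr]] := oT t Tt.
  have := ub_le_sup uT Tr; have := ge_inf lT TNr; lra.
case: T0 => t Tt; exists (inf T), (sup T); split => //.
by have /TE/andP[] := Tt; exact: lt_trans.
Qed.

(** * Walks in multigraphs *)

Section Walk.
Context (T E : Type) (H : multigraph T E) (S : set E).
Implicit Types u v w : T.

(** [e0] is a filler: even a walk of length 0 carries a total function from indices to edges. *)
Lemma mg_walk_refl (e0 : E) u : mg_walk H S u u.
Proof. by exists 0%N, (fun=> u), (fun=> e0). Qed.

Lemma mg_walk_step u v w (e : E) :
  mg_walk H S u v -> S e -> mg_ends H e v w -> mg_walk H S u w.
Proof.
move=> [n [x [a [x0 xn h]]]] Se ew.
exists n.+1, (fun i => if (i <= n)%N then x i else w),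
  (fun i => if (i < n)%N then a i else e).
split=> [||i]; [by rewrite leq0n|by rewrite ltnn|rewrite ltnS => le_in].
rewrite le_in; have [lt|ge] := ltnP i n; first exact: h.
by have /eqP -> : i == n; rewrite ?xn // eqn_leq le_in.
Qed.

Lemma mg_walk_trans u v w : mg_walk H S u v -> mg_walk H S v w -> mg_walk H S u w.
Proof.
move=> uv [n [x [a [x0 <- h]]]]; elim: n h => [|n IH] h; first by rewrite x0.
have [Sa ea] := h n (ltnSn n); apply: (mg_walk_step _ Sa ea).
by apply: IH => i lt; apply: h; rewrite ltnS ltnW.
Qed.

Lemma mg_walk_sym : (forall e u v, mg_ends H e u v -> mg_ends H e v u) ->
  forall u v, mg_walk H S u v -> mg_walk H S v u.
Proof.
move=> sym u v [n [x [a [x0 xn h]]]].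
(* Edge number [j] joins vertices [j] and [j + 1], so step [i] of the reversed walk uses edge
   [n - i - 1]. *)
exists n, (fun i => x (n - i)%N), (fun i => a (n - i.+1)%N).
split; [by rewrite subn0|by rewrite subnn|move=> i lt].
have [|Sa ea] := h (n - i.+1)%N; first by rewrite ltn_subrL (leq_ltn_trans _ lt).
by split=> //; apply: sym; move: ea; rewrite -subSn // subSS.
Qed.

End Walk.

(** * Tropical series *)

Section Domain.
Context {R : realType} (Omega : set (plane R)).
Hypothesis polyO : rational_polygon Omega.
Implicit Types (x y z u v q : plane R) (m k : lattice) (A B W : set (plane R)).

Lemma polygon_convex : convex Omega.
Proof.
case: polyO => [[s [n [a [_ ->]]]] _ _] x y t /= xO yO /andP[t0 t1] r.
rewrite segE dotDr !dotZr.
have -> : (1 - t) * dot (lat (n r)) x + t * dot (lat (n r)) y + a r =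
  (1 - t) * (dot (lat (n r)) x + a r) + t * (dot (lat (n r)) y + a r) by ring.
by rewrite addr_ge0 // mulr_ge0 ?subr_ge0.
Qed.

Lemma polygon_closed : closed Omega.
Proof.
by case: polyO => _ cO _; apply: compact_closed cO; exact: norm_hausdorff.
Qed.

Lemma bd_polygonE x : bd Omega x <-> Omega x /\ ~ Omega° x.
Proof.
have cO := closure_id Omega; split => [[cx ix]|[Ox ix]]; split => //.
  by have/cO -> := polygon_closed.
exact: subset_closure.
Qed.

Lemma interior_half x u (t : R) : Omega x -> Omega° u -> 0 < t <= 1 ->
  Omega° (x + t *: (u - x)).
Proof. exact/convex_interior_half/polygon_convex. Qed.

(** A segment from an interior point to a point beyond the norm bound of [Omega] has to cross the
    boundary. *)
Lemma bd_nonempty : bd Omega !=set0.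
Proof.
case: polyO => _ cO [u Ou].
have [M [_ /(_ (M + 1))] hM] := compact_bounded cO.
have {}hM : forall x, Omega x -> `|x| <= M + 1.
  by move=> x Ox; apply: hM => //; rewrite ltrDl.
pose x : plane R := (`|M| + 2, 0).
have nOx : ~ Omega x.
  move=> /hM; rewrite leNgt => /negP; apply.
  rewrite /x prod_normE /= lt_max; apply/orP; left.
  rewrite ger0_norm ?addr_ge0//; have := ler_norm M; lra.
have [z [_ [cz iz]]] : closed_seg u x `&` bd Omega° !=set0.
  apply: connected_meets_bd; first exact: closed_seg_connected.
  - exact: open_interior.
  - by exists u; split => //; exact: closed_segl.
  - by move=> /(_ x (closed_segr _ _)) /interior_subset.
exists z; apply/bd_polygonE; split.
  by have /closure_id -> := polygon_closed; apply: closureS cz;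
    exact: interior_subset.
by rewrite -(iffLR (interior_id _) (@open_interior _ Omega)).
Qed.

Section Tropical.
Context (F : plane R -> R).
Hypothesis tropF : tropical_series Omega F.

(* If F y exceeded the affine function, then along the segment from x to y the
   difference minus its linear interpolation, perturbed by a small strictly
   concave term, would have an interior minimum, which the local supporting
   affine function at that point forbids. *)
Lemma tropical_support x q (c : R) : Omega° x ->
  (\forall y \near x, F y <= c + dot q y) -> F x = c + dot q x ->
  forall y, Omega y -> F y <= c + dot q y.
Proof.
move=> Ox Fle Fx y Oy; rewrite leNgt; apply/negP => Fy.
pose l (t : R) := x + t *: (y - x).
have lO t : 0 <= t <= 1 -> Omega (l t).
  by apply: polygon_convex => //; exact: interior_subset.
have lOi t : 0 <= t < 1 -> Omega° (l t).
  move=> /andP[t0 t1]; rewrite /l seg_sym; apply: interior_half => //.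
  by rewrite subr_gt0 t1 gerBl.
pose g1 := F y - (c + dot q y).
have g10 : 0 < g1 by rewrite subr_gt0.
(* [k] agrees with [F] along the segment at both ends and is strictly convex. Its quadratic
   coefficient [g1 / 2] is below [g1], which keeps [k] above the affine function plus a positive
   multiple of [t]. *)
pose k (t : R) := (c + dot q x) + (dot q (y - x) + g1 / 2) * t + g1 / 2 * (t * t).
have kE t : k t = c + dot q (l t) + g1 * t - g1 / 2 * (t * (1 - t)).
  by rewrite /k /l (dotDr q x) dotZr; field.
have kc : continuous k by exact: quadratic_continuous.
pose h t := F (l t) - k t.
have hc : {within `[0, 1], continuous h}.
  apply/subspace_continuousP => t t01; apply: cvgB; last first.
    exact: cvg_within_filter (kc t).
  case: tropF => /subspace_continuousP FC _ _ _.
  have Olt : Omega (l t) by apply: lO; move: t01; rewrite /= in_itv.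
  apply: cvg_comp (FC _ Olt) => B.
  move=> BB; have lc : \forall s \near t, Omega (l s) -> B (l s).
    exact: (@line_continuous _ x (y - x) t _ BB).
  have : \forall s \near t, `[0, 1]%classic s -> B (l s).
    by apply: filterS lc => s hs s01; apply: hs; apply: lO; move: s01;
      rewrite /= in_itv.
  exact.
have [t0 t001 tmin] := EVT_min ler01 hc.
have h0 : h 0 = 0.
  by rewrite /h kE /l scale0r addr0 Fx !(mul0r, mulr0) subr0 addr0 subrr.
have h1 : h 1 = 0.
  by rewrite /h kE /l scale1r subrKC /g1; ring.
(* Close to 0 the local hypothesis bounds [h t] by [- g1 * t + g1 / 2 * (t * (1 - t))], so the
   minimum is negative and is not attained at an end. *)
have ht0 : h t0 < 0.
  have [t [tp tl Flt _]] := near_line_sym (y - x) Fle ltr01.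
  rewrite -/(l t) in Flt.
  apply: (@le_lt_trans _ _ (h t)); first by apply: tmin; rewrite in_itv /= !ltW.
  rewrite /h kE; have : 0 < g1 * t by exact: mulr_gt0.
  have : 0 < g1 * (t * t) by rewrite !mulr_gt0.
  lra.
have /andP[t0p t0l] : 0 < t0 < 1.
  move: t001; rewrite in_itv /= !le_eqVlt =>
    /andP[/orP[/eqP e|->] /orP[/eqP e'|->]] //;
  by move: ht0; rewrite -?e ?e' ?h0 ?h1 ltxx.
have Olt0 : Omega° (l t0) by apply: lOi; rewrite ltW.
case: tropF => _ _ _ /(_ _ Olt0)[A [d FA]].
have [_ [m mA Fm]] := nbhs_singleton FA.
have FA' : \forall z \near l t0, F z <= d m + dot (lat m) z.
  by apply: filterS FA => z [/(_ m mA)].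
have b0 : 0 < Num.min t0 (1 - t0) by rewrite lt_min t0p subr_gt0.
have [r [r0 rb Fr FNr]] := near_line_sym (y - x) FA' b0.
move: rb; rewrite lt_min => /andP[rt0 rt1].
have e t : l t0 + t *: (y - x) = l (t0 + t) by rewrite /l scalerDl addrA.
rewrite !e in Fr FNr.
(* A piece active at [l t0] is affine along the line, so the second difference of [h] at [t0] with
   step [r] is at most [- g1 * (r * r)], against minimality. *)
have hr : h t0 <= h (t0 + r) by apply: tmin; rewrite in_itv /=; lra.
have hNr : h t0 <= h (t0 - r) by apply: tmin; rewrite in_itv /=; lra.
have rr : 0 < g1 / 2 * (r * r) by rewrite !mulr_gt0 // divr_gt0.
move: hr hNr; rewrite /h !kE; move: Fr FNr; rewrite -!e Fm !(dotDr, dotZr).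
lra.
Qed.

(** * Global affine pieces and linearity cells *)

Definition upper_const m : R := sup [set F y - dot (lat m) y | y in Omega].

Definition upper m y : R := upper_const m + dot (lat m) y.

Definition active x m : Prop := F x = upper m x.

Lemma trop_ge0 x : Omega x -> 0 <= F x.
Proof. by case: tropF => _ + _ _; apply. Qed.

Lemma trop_bd0 x : bd Omega x -> F x = 0.
Proof. by case: tropF => _ _ + _; apply. Qed.

Lemma trop_within : {within Omega, continuous F}.
Proof. by case: tropF. Qed.

Lemma trop_sub_bounded q : exists2 M : R, 0 < M & forall y,
  Omega y -> F y - dot q y <= M.
Proof.
case: polyO => _ cO [u /interior_subset Ou].
have [||z zO zmax] := @compact_EVT_max _ R (fun y => F y - dot q y) Omega _ cO.
- by exists u.
- apply/subspace_continuousP => x Ox; apply: cvgB.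
    by have /subspace_continuousP := trop_within; exact.
  exact: cvg_within_filter (@dot_continuous _ q x).
exists (`|F z - dot q z| + 1); first by rewrite ltr_wpDl.
move=> y Oy; have := zmax y; rewrite inE => /(_ Oy).
have := ler_norm (F z - dot q z); lra.
Qed.

Lemma trop_bounded : exists2 M : R, 0 < M & forall y, Omega y -> F y <= M.
Proof.
have [M M0 h] := trop_sub_bounded 0; exists M => // y /h.
by rewrite /dot /= !mul0r addr0 subr0.
Qed.

Lemma upper_ge m y : Omega y -> F y <= upper m y.
Proof.
move=> Oy; rewrite /upper -lerBlDr; apply: sup_ubound; last by exists y.
have [M _ hM] := trop_sub_bounded (lat m).
by exists M => _ [z Oz <-]; exact: hM.
Qed.

Lemma upper_const_le m (c : R) : (forall y, Omega y -> F y <= c + dot (lat m) y) ->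
  upper_const m <= c.
Proof.
move=> h; apply: sup_le_ub; last by move=> _ [y Oy <-]; rewrite lerBlDr; exact: h.
by case: polyO => _ _ [u /interior_subset Ou]; exists (F u - dot (lat m) u), u.
Qed.

Lemma upper_const_eq x m (c : R) : Omega x ->
  (forall y, Omega y -> F y <= c + dot (lat m) y) -> F x = c + dot (lat m) x ->
  upper_const m = c.
Proof.
move=> Ox h Fx; apply/eqP; rewrite eq_le upper_const_le //=.
by have := upper_ge m Ox; rewrite /upper Fx lerD2r.
Qed.

(** The passage from local to global: the constant of a piece touching [F] from above near [x] does
    not depend on [x]. *)
Lemma active_local x m (c : R) : Omega° x ->
  (\forall y \near x, F y <= c + dot (lat m) y) -> F x = c + dot (lat m) x ->
  upper_const m = c.
Proof.
move=> Ox h Fx; apply: (@upper_const_eq x) => //; first exact: interior_subset.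
exact: tropical_support h Fx.
Qed.

Lemma local_active x : Omega° x -> exists A : seq lattice,
  (forall m, m \in A -> active x m) /\
  \forall y \near x, exists2 m, m \in A & active y m.
Proof.
move=> Ox; case: tropF => _ _ _ /(_ _ Ox)[A [c FA]].
have [Fle [m0 m0A Fm0]] := nbhs_singleton FA.
pose B := [seq m <- A | F x == c m + dot (lat m) x].
have Bc m : m \in B -> upper_const m = c m.
  rewrite mem_filter => /andP[/eqP Fx mA]; apply: active_local Fx => //.
  by apply: filterS FA => y [/(_ _ mA)].
exists B; split=> [m mB|].
  rewrite /active /upper Bc //.
  by move: mB; rewrite mem_filter => /andP[/eqP].
have strict : \forall y \near x, forall m, m \in A -> m \notin B ->
    c m0 + dot (lat m0) y < c m + dot (lat m) y.
  apply: near_seq => m mA; have [mB|mB] := boolP (m \in B);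
    first by apply: filterE => y /negP[].
  have lt : 0 < (c m - c m0) + dot (lat m - lat m0) x.
    rewrite dotBl; have := Fle m mA; rewrite le_eqVlt => /orP[/eqP e|].
      by move: mB; rewrite mem_filter mA e eqxx.
    rewrite Fm0; lra.
  by apply: filterS (near_affine_gt0 lt) => y; rewrite dotBl => + _; lra.
apply: filterS2 FA strict => y [Fy_le [m mA Fy]] st; exists m; last first.
  have [mB|mB] := boolP (m \in B); first by rewrite /active /upper Bc.
  have := st m mA mB; rewrite -Fy => h; have := Fy_le m0 m0A; lra.
apply/negPn/negP => mB.
by have := st m mA mB; rewrite -Fy => h; have := Fy_le m0 m0A; lra.
Qed.

Lemma interior_or_bd x : Omega x -> Omega° x \/ bd Omega x.
Proof.
by move=> Ox; have [|nO] := pselect (Omega° x); [left|right; exact/bd_polygonE].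
Qed.

Lemma ex_active x : Omega° x -> exists m, active x m.
Proof. by move=> /local_active[A [_ /nbhs_singleton[m _]]]; exists m. Qed.

(** At an interior point a piece is active and dominates [F] at both ends. If a point strictly
    between [x] and [y] lies on the boundary, so do [x] and [y], and all values vanish. *)
Lemma trop_concave x y (t : R) : Omega x -> Omega y -> 0 <= t <= 1 ->
  (1 - t) * F x + t * F y <= F (x + t *: (y - x)).
Proof.
move=> Ox Oy t01.
have [Oz|bz] := interior_or_bd (polygon_convex Ox Oy t01).
  have [m ->] := ex_active Oz; case/andP: t01 => t0 t1.
  rewrite /upper segE dotDr !dotZr.
  have := upper_ge m Ox; have := upper_ge m Oy; rewrite /upper; nra.
have [->|tn0] := eqVneq t 0; first by rewrite subr0 mul1r mul0r scale0r !addr0.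
have [->|tn1] := eqVneq t 1;
  first by rewrite subrr mul1r mul0r scale1r subrKC add0r.
case/andP: t01 => t0 t1; have [_ nOz] := (bd_polygonE _).1 bz.
rewrite (trop_bd0 bz) (@trop_bd0 x) ?(@trop_bd0 y) ?mulr0 ?addr0 //.
  apply/bd_polygonE; split=> // Oiy; apply: nOz; apply: interior_half => //.
  by rewrite lt0r tn0 t0.
apply/bd_polygonE; split=> // Oix; apply: nOz; rewrite seg_sym.
by apply: interior_half => //; rewrite subr_gt0 lt_neqAle tn1 t1 gerBl.
Qed.

(** The closed linearity cell of gradient [m], but defined for every [m]: it may also be empty, a
    point or a segment, and then its interior [cell m] is empty. *)
Definition contact m : set (plane R) := [set x | Omega x /\ active x m].

Definition cell m : set (plane R) := (contact m)°.

Lemma contact_convex m : convex (contact m).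
Proof.
move=> x y t [Ox Fx] [Oy Fy] t01; have Oz := polygon_convex Ox Oy t01; split => //.
apply/eqP; rewrite /active eq_le upper_ge //=
  (le_trans _ (trop_concave Ox Oy t01)) //.
by rewrite Fx Fy /upper segE dotDr !dotZr; lra.
Qed.

Lemma cell_convex m : convex (cell m).
Proof. exact/convex_interior/contact_convex. Qed.

Lemma cell_open m : open (cell m).
Proof. exact: open_interior. Qed.

Lemma cell_contact m : cell m `<=` contact m.
Proof. exact: interior_subset. Qed.

Lemma cell_interior m : cell m `<=` Omega°.
Proof. by apply: interiorS => x []. Qed.

Lemma cell_intro x m : Omega° x -> (\forall y \near x, active y m) -> cell m x.
Proof. by move=> Ox Fm; apply: filterS2 Ox Fm => y; split. Qed.

(** On [cell m] the difference [upper k - upper m] is affine and nonnegative, and it vanishes at the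
    interior point [x], so its gradient is 0. *)
Lemma cell_unique x m k : cell m x -> active x k -> k = m.
Proof.
move=> mx kx; apply: (@lat_inj R); apply/eqP; rewrite -subr_eq0 -latB; apply/eqP.
have Ox := cell_interior mx.
apply: (@affine_min_cst _ x _ (upper_const k - upper_const m)).
  apply: filterS mx => y [Oy]; rewrite latB dotBl /active => Fm.
  by have := upper_ge k Oy; rewrite Fm /upper; lra.
case: (cell_contact mx) => _; move: kx;
  rewrite latB dotBl /active /upper => -> ; lra.
Qed.

Lemma upper_near x m (c : R) : Omega° x ->
  (\forall y \near x, F y = c + dot (lat m) y) -> upper_const m = c.
Proof.
move=> Ox Fm; apply: (active_local Ox); last exact: nbhs_singleton Fm.
by apply: filterS Fm => y ->.
Qed.

(** * Cells and edges of the corner locus *)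

Local Notation V := (corner_locus Omega F).
Local Notation nodeset := (tropical_vertex Omega F).
Local Notation Gamma := (tropical_graph Omega F).

(** Replaces an unspecified local form by the global pieces. Conversely, any two active gradients
    may be added to a local form, since every [upper j] dominates [F]. *)
Lemma corner_activeP x : V x <->
  Omega° x /\ exists m k, [/\ m != k, active x m & active x k].
Proof.
split=> [[Ox [A [c [FA [m [k [mA kA mk Fm Fk]]]]]]]|[Ox [m [k [mk am ak]]]]];
  split=> //.
  have cE l : l \in A -> F x = c l + dot (lat l) x -> active x l.
    move=> lA Fl; rewrite /active /upper (@active_local x l (c l)) //.
    by apply: filterS FA => y [/(_ l lA)].
  by exists m, k; split=> //; exact: cE.
have [A [_ FA]] := local_active Ox.
exists [:: m, k & A], upper_const; split.
  apply: filterS2 Ox FA => y Oy [l lA al]; split; first by move=> j _;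
    exact: upper_ge.
  by exists l => //; rewrite !inE lA !orbT.
by exists m, k; split=> //; rewrite !inE eqxx ?orbT.
Qed.

Lemma cell_not_corner x m : cell m x -> ~ V x.
Proof.
move=> mx /corner_activeP[_ [k [l [kl /(cell_unique mx) e /(cell_unique mx) e']]]].
by move: kl; rewrite e e' eqxx.
Qed.

Lemma corner_or_cell x : Omega° x -> V x \/ exists m, cell m x.
Proof.
move=> Ox; have [|nV] := pselect (V x); [by left|right].
have [A [aA FA]] := local_active Ox.
have [m0 m0A am0] := nbhs_singleton FA.
exists m0; apply: cell_intro => //; apply: filterS FA => y [m mA am].
have [<-//|mm0] := eqVneq m m0.
by exfalso; apply: nV; apply/corner_activeP; split => //; exists m, m0;
  split => //; exact: aA.
Qed.

Lemma corner_interior : V `<=` Omega°.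
Proof. by move=> x []. Qed.

Lemma corner_closed x : Omega° x -> closure V x -> V x.
Proof.
move=> Ox cx; have [//|[m mx]] := corner_or_cell Ox.
have [y [Vy my]] := cx _ (open_nbhs_nbhs (conj (@cell_open m) mx)).
by have := cell_not_corner my.
Qed.

(** The local model of a relatively interior point of an edge: two pieces describe [F] near [x]. A
    third gradient may still be active at [x], but its cell does not come near [x]. *)
Definition germ m k x : Prop := [/\ m != k, Omega° x, active x m, active x k &
  \forall y \near x, active y m \/ active y k].

Lemma germ_sym m k x : germ m k x -> germ k m x.
Proof.
by case=> mk Ox am ak h; split; rewrite // 1?eq_sym //;
  apply: filterS h => y [|]; [right|left].
Qed.

Lemma germ_corner m k x : germ m k x -> V x.
Proof. by case=> mk Ox am ak _; apply/corner_activeP; split => //; exists m, k. Qed.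

Lemma strict_cell m k x : Omega° x ->
  (\forall y \near x, active y m \/ active y k) ->
  upper m x < upper k x -> cell m x.
Proof.
move=> Ox h lt; apply: cell_intro => //.
have lt' : 0 < (upper_const k - upper_const m) + dot (lat k - lat m) x.
  by move: lt; rewrite /upper dotBl; lra.
apply: filterS3 Ox h (near_affine_gt0 lt') => y Oy [//|ak].
by have := upper_ge m Oy; rewrite ak /upper dotBl; lra.
Qed.

(** Where the two pieces differ, the lower one fills a cell, which contains no corner. *)
Lemma germ_near m k x : germ m k x -> \forall y \near x, V y -> germ m k y.
Proof.
move=> [mk Ox am ak h].
have Ox' : nbhs x Omega° by exact: nbhs_interior Ox.
have h' : \forall y \near x, nbhs y [set z | active z m \/ active z k].
  exact: nbhs_interior h.
apply: filterS2 Ox' h' => y Oy hy Vy.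
have hy' : \forall z \near y, active z k \/ active z m.
  by apply: filterS hy => z [|]; [right|left].
have [amy aky] : active y m /\ active y k; last by split.
have [lt|lt|e] := ltgtP (upper m y) (upper k y).
- by have /cell_not_corner := strict_cell Oy hy lt.
- by have /cell_not_corner := strict_cell Oy hy' lt.
- by case: (nbhs_singleton hy); rewrite /active e.
Qed.

Lemma germ_upperB m k x w : germ m k x ->
  upper m (x + w) - upper k (x + w) = dot (lat m - lat k) w.
Proof. by case=> _ _; rewrite /active /upper dotBl !dotDr => -> e _; lra. Qed.

Lemma near_right (P : R -> Prop) : (\forall t \near (0 : R), P t) ->
  \forall t \near (0 : R)^'+, P t.
Proof. by move=> h; apply: filterS h => t. Qed.

Lemma germ_side m k x v : germ m k x -> dot (lat m - lat k) v < 0 ->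
  \forall t \near (0 : R)^'+, cell m (x + t *: v).
Proof.
move=> g nv; case: (g) => mk Ox am ak h.
have Ox' : \forall y \near x, Omega° y by exact: nbhs_interior Ox.
have h' : \forall y \near x, nbhs y [set z | active z m \/ active z k].
  exact: nbhs_interior h.
have t0 : \forall t \near (0 : R)^'+, 0 < t by exact: nbhs_right_gt.
apply: filterS3 t0 (near_right (near_line v Ox')) (near_right (near_line v h'))
  => t t0 Ot ht.
apply: (@strict_cell _ k) => //; rewrite -subr_lt0 germ_upperB // dotZr.
by rewrite pmulr_rlt0.
Qed.

Lemma latB_neq0 m k : m != k -> lat m - lat k != 0 :> plane R.
Proof. by move=> mk; rewrite -latB lat_eq0 subr_eq0. Qed.

Lemma right_closure A x v : (\forall t \near (0 : R)^'+, A (x + t *: v)) ->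
  closure A x.
Proof.
move=> h B xB.
have : \forall t \near (0 : R)^'+, A (x + t *: v) /\ B (x + t *: v).
  by apply: filterS2 h (near_right (near_line v xB)) => t.
by move=> /filter_ex[t [At Bt]]; exists (x + t *: v).
Qed.

Lemma germ_closure m k x : germ m k x -> closure (cell m) x.
Proof.
move=> g; apply: (@right_closure _ _ (- (lat m - lat k))).
apply: (germ_side g); rewrite dotNr oppr_lt0 dot_gt0 // latB_neq0 //.
by case: g.
Qed.

(** Makes the gradients of a germ intrinsic: they are those of the cells whose closure contains [x].
    Hence a germ is unique up to exchange. *)
Lemma germ_cell_mem m k l x : germ m k x -> closure (cell l) x -> l = m \/ l = k.
Proof.
move=> [_ _ _ _ h] /(_ _ h)[y [ly [am|ak]]]; [left|right]; symmetry;
  exact: cell_unique ly _.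
Qed.

Lemma germ_unique m k m' k' x : germ m k x -> germ m' k' x ->
  (m' = m /\ k' = k) \/ (m' = k /\ k' = m).
Proof.
move=> g g'; have [mk' _ _ _ _] := g'.
have [e|e] := germ_cell_mem g (germ_closure g');
have [e'|e'] := germ_cell_mem g (germ_closure (germ_sym g')); subst;
  tauto || by rewrite eqxx in mk'.
Qed.

Lemma germ_transfer m k m' k' x y : germ m k x -> germ m' k' x -> germ m' k' y ->
  germ m k y.
Proof. by move=> g g'; have [[-> ->]|[-> ->]] := germ_unique g g' => //;
  exact: germ_sym. Qed.

Lemma active_superdifferential x m : active x m -> superdifferential Omega F x
  (lat m).
Proof.
by move=> am y Oy; rewrite am dotBr; have := upper_ge m Oy; rewrite /upper; lra.
Qed.

(** Off the vertices the active gradients are collinear, along [n]. The two extreme ones describe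
    [F] near [x]: the one minimising [dot n] wins where [dot n (y - x)] is nonnegative, the
    maximising one on the other side. They differ, since otherwise [x] would lie in a cell. *)
Lemma corner_germ x : V x -> ~ nodeset x -> exists m k, germ m k x.
Proof.
move=> /corner_activeP[Ox [m1 [m2 [m12 am1 am2]]]] nx.
pose n : plane R := lat m2 - lat m1.
have n0 : n != 0 by rewrite latB_neq0 // eq_sym.
have nn := dot_gt0 n0.
have col l : active x l -> det2 n (lat l - lat m1) = 0.
  move=> al; apply/eqP/negPn/negP => d0; apply: nx; split=> //.
  by exists (lat m1), (lat m2), (lat l); split=> //;
    exact: active_superdifferential.
have colw l l' w : active x l -> active x l' ->
    dot n n * dot (lat l - lat l') w = (dot n (lat l) - dot n (lat l')) * dot n w.
  move=> /col hl /col hl'; have := collinear_dot w hl hl'.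
  by rewrite opprB addrA subrK !dotBr => ->; congr (_ * _); lra.
have [A [aA FA]] := local_active Ox.
have [m0 m0A am0] := nbhs_singleton FA.
have [m mA mmin] := seq_argmin (fun l => dot n (lat l)) m0A.
have [k kA kmax] := seq_argmin (fun l => - dot n (lat l)) m0A.
have h : \forall y \near x, active y m \/ active y k.
  have OO : nbhs x Omega by [].
  apply: filterS2 OO FA => y Oy [l lA al].
  have key j : j \in A -> upper j y <= upper l y -> active y j.
    by move=> jA le; apply/eqP; rewrite /active eq_le upper_ge //= al.
  have ulE j : j \in A -> dot n n * (upper l y - upper j y) =
      (dot n (lat l) - dot n (lat j)) * dot n (y - x).
    move=> jA; rewrite -colw; [|exact: aA|exact: aA]; congr (_ * _).
    by have := aA _ jA; have := aA _ lA; rewrite /active /upper dotBl !dotBr; lra.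
  have [s0|s0] := leP 0 (dot n (y - x)).
    left; apply: key => //; rewrite -subr_ge0 -(pmulr_rge0 _ nn) ulE //.
    by rewrite mulr_ge0 // subr_ge0 mmin.
  right; apply: key => //; rewrite -subr_ge0 -(pmulr_rge0 _ nn) ulE //.
  by rewrite mulr_le0 ?(ltW s0) // subr_le0 -lerN2 kmax.
exists m, k; split=> //; try exact: aA.
apply/eqP => e; have mx : cell m x.
  by apply: cell_intro => //; apply: filterS h => y; rewrite -e => -[].
apply: (cell_not_corner mx); apply/corner_activeP; split=> //.
by exists m1, m2.
Qed.

Lemma active_upper_le y m k : Omega y -> active y m \/ active y k ->
  upper m y <= upper k y -> active y m.
Proof.
move=> Oy [//|ak] le; apply/eqP; rewrite /active eq_le upper_ge //=.
by rewrite ak.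
Qed.

(** The value of [upper m - upper k] at [x + w] and at [y + w] depends on [w] alone. So for small
    [w] the same piece is active at both translated ends, and by convexity of its contact set also
    between them. *)
Lemma germ_convex m k : convex (germ m k).
Proof.
move=> x y t gx gy t01; have [mk Ox amx akx hx] := gx; have [_ Oy amy aky hy] := gy.
have Oz : Omega° (x + t *: (y - x)) by exact: convex_interior polygon_convex _
  _ _ _ _ _.
have cm j : active x j -> active y j -> active (x + t *: (y - x)) j.
  by move=> jx jy; apply: (contact_convex (conj _ jx) (conj _ jy) t01).2;
    exact: interior_subset.
split=> //; try exact: cm.
have [r1 r10 /= h1] := near_ball (filterI Ox hx).
have [r2 r20 /= h2] := near_ball (filterI Oy hy).
apply: (@ball_near _ _ _ (Num.min r1 r2)); first by rewrite lt_min r10.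
move=> w; rewrite lt_min => /andP[/h1[Oxw axw] /h2[Oyw ayw]].
have -> : x + t *: (y - x) + w = (x + w) + t *: ((y + w) - (x + w)).
  by apply: plane_eq; rewrite /= /GRing.scale /=; ring.
have main a b : (active (x + w) a \/ active (x + w) b) ->
  (active (y + w) a \/ active (y + w) b) ->
    upper a (x + w) <= upper b (x + w) -> upper a (y + w) <= upper b (y + w) ->
    active (x + w + t *: (y + w - (x + w))) a.
  move=> hxw hyw lx ly; apply: (contact_convex (conj Oxw _) (conj Oyw _) t01).2.
    exact: active_upper_le lx.
  exact: active_upper_le ly.
have [d0|d0] := leP (dot (lat m - lat k) w) 0.
  by left; apply: main axw ayw _ _;
    rewrite -subr_le0 (germ_upperB w gx, germ_upperB w gy).
right; apply: (main k m); try (by apply/or_comm); rewrite -subr_ge0.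
  by rewrite (germ_upperB w gx) ltW.
by rewrite (germ_upperB w gy) ltW.
Qed.

(** On the line through [x] along [v] the two pieces coincide, so one being active makes both
    active. *)
Lemma germ_line m k x v : germ m k x -> dot (lat m - lat k) v = 0 ->
  exists r : R, [/\ 0 < r, germ m k (x + r *: v) & germ m k (x + (- r) *: v)].
Proof.
move=> gx nv; have [mk Ox _ _ h] := gx.
have [] := @near_line_sym _ x v _ 1
  (filterI (germ_near gx) (filterI Ox (filterI (nbhs_interior Ox) h))) ltr01.
move=> r [r0 _ [g1 [dO1 [dOi1 h1]]] [g2 [dO2 [dOi2 h2]]]].
have main s : Omega (x + s *: v) -> Omega° (x + s *: v) ->
    active (x + s *: v) m \/ active (x + s *: v) k -> V (x + s *: v).
  move=> Os Ois hs.
  have e : upper m (x + s *: v) = upper k (x + s *: v).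
    by apply/eqP; rewrite -subr_eq0 germ_upperB // dotZr nv mulr0.
  apply/corner_activeP; split=> //; exists m, k.
  by move: hs; rewrite /active e => -[|] ->.
by exists r; split=> //; [apply: g1; exact: main|apply: g2; exact: main].
Qed.

(** [F] equals the piece [m] at [x] and at two opposite points of the edge; testing a supergradient
    there fixes its component along the edge, so all supergradients lie on one line. *)
Lemma germ_not_vertex m k x : germ m k x -> ~ nodeset x.
Proof.
move=> gx [_ [a [b [c [Sa Sb Sc]]]]]; apply/negP/negPn/eqP.
have [mk Ox am ak h] := gx.
have n0 := latB_neq0 mk.
pose v := rot90 (lat m - lat k : plane R).
have v0 : v != 0 by rewrite rot90_eq0.
have nv : dot (lat m - lat k) v = 0 by exact: dot_rot90.
have [r [r0 [_ dO1 a1 _ _] [_ dO2 a2 _ _]]] := germ_line gx nv.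
have main q : superdifferential Omega F x q -> dot v q = dot v (lat m).
  move=> Sq; have := Sq _ (interior_subset dO1); have := Sq _ (interior_subset dO2).
  rewrite a1 a2 am /upper !dotDr !dotNr !dotZr => h1 h2.
  have l1 : r * dot (lat m) v <= r * dot q v by lra.
  have l2 : r * dot q v <= r * dot (lat m) v by lra.
  rewrite !(dotC v); apply/eqP; rewrite eq_le.
  by move: l1 l2; rewrite !ler_pM2l // => -> ->.
by apply: (det2_dot0 v0); rewrite dotBr !main // subrr.
Qed.

(** The points with this germ form a convex set. Within the component it is open by [germ_near], and
    closed because every other point has a germ of its own, which spreads to its neighbours and
    excludes [germ m k]. *)
Lemma edge_through_germ m k x : germ m k x ->
  edge_through Gamma x = [set y | germ m k y].
Proof.
move=> gx; rewrite /edge_through /=; apply/seteqP; split; last first.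
  apply: connected_component_max => //; last exact/convex_connected/germ_convex.
  by move=> y gy; split; [exact: germ_corner gy|exact: germ_not_vertex gy].
set K := connected_component _ _.
have KV y : K y -> V y /\ ~ nodeset y by move=> /connected_component_sub.
have Kx : K x.
  by apply: connected_component_refl; split;
    [exact: germ_corner gx|exact: germ_not_vertex gx].
have <- : K `&` [set y | germ m k y] = K; last exact: subIsetr.
apply: (@component_connected _ _ _ (K `&` [set y | germ m k y])).
- by exists x.
- exists [set z | V z -> germ m k z]°; first exact: open_interior.
  apply/seteqP; split=> y [Ky gy]; split => //; first exact: germ_near.
  by apply: (interior_subset gy); have [] := KV y Ky.
exists (~` [set z | V z -> ~ germ m k z]°).
  by apply: open_closedC; exact: open_interior.
apply/seteqP; split=> y [Ky gy]; split => //.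
  by move=> /interior_subset; apply => //; exact: germ_corner gy.
have [Vy ny] := KV y Ky.
have [m' [k' g']] := corner_germ Vy ny.
apply: contrapT => ngy; apply: gy.
apply: filterS (germ_near g') => z gz Vz gz'; apply: ngy.
exact: germ_transfer gz' (gz Vz) g'.
Qed.

Lemma open_seg_sym a b : open_seg a b = open_seg b a :> set (plane R).
Proof.
have sub (x y : plane R) : open_seg x y `<=` open_seg y x.
  move=> _ [t /= /andP[t0 t1] <-]; exists (1 - t);
    first by rewrite /= subr_gt0 t1 gtrBl.
  by rewrite -seg_sym.
by apply/seteqP; split; exact: sub.
Qed.

Lemma germ_open_seg m k x : germ m k x -> exists a b,
  a != b /\ [set y | germ m k y] = open_seg a b.
Proof.
move=> gx; have [mk Ox _ _ _] := gx.
have n0 := latB_neq0 mk.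
pose v := rot90 (lat m - lat k : plane R).
have v0 : v != 0 by rewrite rot90_eq0.
have nv : dot (lat m - lat k) v = 0 by exact: dot_rot90.
pose T := [set t : R | germ m k (x + t *: v)].
have [M hM] : exists M : R, forall y, Omega y -> `|y| <= M.
  case: polyO => _ cO _; have [M [_ /(_ (M + 1))]] := compact_bounded cO.
  by move=> hM; exists (M + 1) => y; apply: hM; rewrite ltrDl.
(* For [t] in [T] the vector [t *: v] is a difference of two points of [Omega], so its norm is at
   most [M + M]. *)
have [||||a [b [ab TE]]] := @bounded_open_intervalP _ T ((M + M) / `|v|).
- by exists 0; rewrite /T /= scale0r addr0.
- move=> t [_ Ot _ _ _]; rewrite ler_pdivlMr ?normr_gt0 // -normrZ.
  have -> : t *: v = (x + t *: v) - x by rewrite addrC addKr.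
  by apply: (le_trans (ler_normB _ _)); apply: lerD; apply: hM;
    exact: interior_subset.
- move=> t Tt; have [r [r0 g1 g2]] := germ_line Tt nv.
  by exists r; split=> //; rewrite /T /= scalerDl addrA ?scaleNr // -scaleNr.
- move=> a b t Ta Tb /andP[at0 tb].
  have ab : 0 < b - a by rewrite subr_gt0 (lt_trans at0).
  have := germ_convex (t := (t - a) / (b - a)) Ta Tb.
  have -> : x + a *: v + ((t - a) / (b - a)) *: (x + b *: v - (x + a *: v)) = x
    + t *: v.
    by apply: plane_eq; rewrite /= /GRing.scale /=; field; rewrite gt_eqF.
  apply; apply/andP; split; first by apply: divr_ge0; lra.
  by rewrite ler_pdivrMr //; lra.
have b_a : 0 < b - a by rewrite subr_gt0.
exists (x + a *: v), (x + b *: v); split.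
  apply/eqP => /addrI/eqP; rewrite -subr_eq0 -scalerBl scaler_eq0 (negPf v0)
    orbF subr_eq0.
  by rewrite lt_eqF.
have segE t : x + a *: v + t *: (x + b *: v - (x + a *: v)) = x +
  (a + t * (b - a)) *: v.
  by apply: plane_eq; rewrite /= /GRing.scale /=; ring.
apply/seteqP; split=> y /=.
  move=> gy; have yx : dot (lat m - lat k) (y - x) = 0.
    by have := germ_upperB (y - x) gx; rewrite subrKC;
      have [_ _ <- <- _] := gy; rewrite subrr.
  have e := dot0_rot90 n0 yx; rewrite -/v in e; set s := _ / _ in e.
  have /TE/andP[as_ sb] : T s by rewrite /T /= -e subrKC.
  exists ((s - a) / (b - a)).
    by rewrite /= divr_gt0 ?subr_gt0 //= ltr_pdivrMr // mul1r ltrD2r.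
  by rewrite segE divfK ?gt_eqF // subrKC -e subrKC.
move=> [t /= /andP[t0 t1] <-]; rewrite segE; apply/TE.
by rewrite ltrDl mulr_gt0 //= -ltrBrDl -[X in _ < X]mul1r ltr_pM2r.
Qed.

Lemma open_seg_endpoint a b : a != b -> ~ open_seg a b (b : plane R).
Proof.
move=> ab [t /= /andP[t0 t1]]; rewrite seg_sym => /eqP;
  rewrite -subr_eq0 addrC addKr.
by rewrite scaler_eq0 !subr_eq0 (negPf ab) gt_eqF.
Qed.

Lemma open_seg_closure a b : closure (open_seg a b) (b : plane R).
Proof.
apply: (@right_closure _ _ (a - b)).
have h1 : \forall t \near (0 : R)^'+, t < 1 by exact: nbhs_right_lt.
have h2 : \forall t \near (0 : R)^'+, 0 < t by exact: nbhs_right_gt.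
by apply: filterS2 h1 h2 => t t1 t0; rewrite open_seg_sym; exists t; rewrite /= ?t0.
Qed.

(** An end inside [Omega°] is a corner by closedness. If it were not a vertex, its germ would be
    that of the edge, and the open segment would contain its own end. *)
Lemma germ_endpoint m k a b : a != b -> [set y | germ m k y] = open_seg a b ->
  Omega° b -> nodeset b.
Proof.
move=> ab gE Ob; have gb : closure [set y | germ m k y] b.
  by rewrite gE; exact: open_seg_closure.
have Vb : V b.
  by apply: corner_closed => //; apply: closureS gb => y /germ_corner.
apply: contrapT => nb; have [m' [k' g']] := corner_germ Vb nb.
have [y [gy hy]] := gb _ (germ_near g').
have : [set y | germ m k y] b by exact: germ_transfer gy (hy (germ_corner gy)) g'.
by rewrite gE; exact: open_seg_endpoint.
Qed.

Lemma edge_structure x : V x -> ~ nodeset x -> exists m k a b,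
  [/\ germ m k x, a != b, edge_through Gamma x = open_seg a b &
      edge_through Gamma x = [set y | germ m k y]].
Proof.
move=> Vx nx; have [m [k g]] := corner_germ Vx nx.
have [a [b [ab e]]] := germ_open_seg g; exists m, k, a, b.
by rewrite (edge_through_germ g).
Qed.

Lemma contact_closed m x : closure (contact m) x -> contact m x.
Proof.
move=> cx; have Ox : Omega x.
  by have /closure_id -> := polygon_closed; apply: closureS cx => y [].
split=> //; apply/eqP; rewrite /active eq_le upper_ge //= leNgt; apply/negP => lt.
have /subspace_continuousP/(_ x Ox) FC := trop_within.
have UC : upper m y @[y --> within Omega (nbhs x)] --> upper m x.
  exact: cvg_within_filter (@affine_continuous _ (upper_const m) (lat m) x).
have dC : (upper m y - F y) @[y --> within Omega (nbhs x)] --> upper m x - F x.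
  by apply: cvgB.
have d0 : 0 < upper m x - F x by rewrite subr_gt0.
have h : \forall y \near x, Omega y -> 0 < upper m y - F y.
  exact: (cvgr_gt (upper m x - F x) dC _ d0).
have [y [[Oy ay] /(_ Oy)]] := cx _ h.
by rewrite ay subrr ltxx.
Qed.

Lemma closure_cell m x : closure (cell m) x -> contact m x.
Proof. by move=> cx; apply: contact_closed; apply: closureS cx;
  exact: cell_contact. Qed.

Lemma contact_half m x u (t : R) : contact m x -> cell m u -> 0 < t <= 1 ->
  cell m (x + t *: (u - x)).
Proof. exact/convex_interior_half/contact_convex. Qed.

Lemma contact_closure m x : cell m !=set0 -> contact m x -> closure (cell m) x.
Proof.
move=> [u mu] mx; apply: (@right_closure _ _ (u - x)).
have h1 : \forall t \near (0 : R)^'+, t < 1 by exact: nbhs_right_lt.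
have h2 : \forall t \near (0 : R)^'+, 0 < t by exact: nbhs_right_gt.
by apply: filterS2 h1 h2 => t t1 t0; apply: contact_half; rewrite ?t0 ?ltW.
Qed.

(** Four overlapping half-planes surround a box containing [Omega]. Any point outside [Omega°] is
    joined to them along the ray leading away from an interior point [u0]; convexity keeps that ray
    outside. *)
Lemma exterior_connected : connected (~` Omega°).
Proof.
have [u0 Ou0] : Omega° !=set0 by case: polyO.
have [M M0 hM] : exists2 M : R, 0 < M & forall y, Omega y -> `|y| <= M.
  case: polyO => _ cO _; have [M [_ /(_ (`|M| + 1))]] := compact_bounded cO.
  move=> hM; exists (`|M| + 1); first by rewrite ltr_wpDl.
  by move=> y; apply: hM; rewrite ltr_pwDr // ler_norm.
pose H1 := [set x : plane R | M < x.1]; pose H2 := [set x : plane R | M < x.2].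
pose H3 := [set x : plane R | x.1 < - M]; pose H4 := [set x : plane R | x.2 < - M].
have cvx (a b : R) (t : R) : 0 <= t <= 1 -> M < a -> M < b -> M < a + t * (b - a).
  move=> /andP[t0 t1] Ma Mb; have [ab|ba] := leP a b; nra.
have cH1 : connected H1 by apply: convex_connected => x y t /= h1 h2 t01;
  exact: cvx.
have cH2 : connected H2 by apply: convex_connected => x y t /= h1 h2 t01;
  exact: cvx.
have cvxN (a b : R) (t : R) : 0 <= t <= 1 -> a < - M -> b < - M -> a + t *
  (b - a) < - M.
  move=> t01; rewrite ltrNr => h1; rewrite ltrNr => h2;
    have := cvx _ _ t t01 h1 h2; lra.
have cH3 : connected H3 by apply: convex_connected => x y t /= h1 h2 t01;
  exact: cvxN.
have cH4 : connected H4 by apply: convex_connected => x y t /= h1 h2 t01;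
  exact: cvxN.
have cU : connected (((H1 `|` H2) `|` H3) `|` H4).
  apply: connectedU => //; last apply: connectedU => //;
    last apply: connectedU => //.
  - by exists (M + 1, - M - 1); split; [left; left|]; rewrite /H1 /H4 /=; lra.
  - by exists (- M - 1, M + 1); split; [right|]; rewrite /H2 /H3 /=; lra.
  - by exists (M + 1, M + 1); split; rewrite /H1 /H2 /=; lra.
set U := _ `|` H4 in cU.
have UO x : M < `|x| -> ~ Omega° x.
  by move=> h /interior_subset /hM; rewrite leNgt h.
have UE x : U x -> M < `|x|.
  have := ler_norm x.1; have := ler_norm (- x.1); have := ler_norm x.2;
    have := ler_norm (- x.2).
  rewrite !normrN prod_normE lt_max /= => a b c d.
  by move=> [[[|]|]|]; rewrite /H1 /H2 /H3 /H4 /= => h; apply/orP;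
    [left|right|left|right]; lra.
have EU x : M < `|x| -> U x.
  rewrite prod_normE lt_max !lter_normr /= => /orP[/orP[h|h]|/orP[h|h]].
  - by left; left; left.
  - by left; right; rewrite /H3 /=; lra.
  - by left; left; right.
  - by right; rewrite /H4 /=; lra.
pose z : plane R := (M + 1, 0).
have Uz : U z by left; left; left; rewrite /H1 /=; lra.
have -> : ~` Omega° = connected_component (~` Omega°) z;
  last exact: component_connected.
apply/seteqP; split; last exact: connected_component_sub.
move=> y nOy; pose t := 1 + (M + `|u0| + 1) / `|y - u0|.
have yo : y - u0 != 0 by rewrite subr_eq0; apply/eqP => e; apply: nOy; rewrite e.
(* With this [t] the norm of [t *: (y - u0)] exceeds [M] plus the norm of [u0], which puts [w]
   outside the box. *)
have yo0 : 0 < `|y - u0| by rewrite normr_gt0.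
have t1 : 1 < t by rewrite ltrDl divr_gt0 // ltr_wpDl // addr_ge0 // ltW.
pose w := u0 + t *: (y - u0).
have Uw : U w.
  apply: EU; rewrite /w; have := lerB_normD (t *: (y - u0)) u0.
  rewrite [t *: _ + u0]addrC; apply: lt_le_trans; rewrite normrZ gtr0_norm;
    last by lra.
  rewrite /t mulrDl mul1r divfK ?gt_eqF //; lra.
suff : closed_seg y w `|` U `<=` connected_component (~` Omega°) z.
  by apply; left; exact: closed_segl.
apply: connected_component_max; first by right.
  move=> x [[s /= /andP[s0 s1] <-]|/UE/UO//] Ox; apply: nOy.
  pose r := 1 + s * (t - 1).
  have r1 : 1 <= r by rewrite lerDl mulr_ge0 // subr_ge0 ltW.
  have r0 : 0 < r by lra.
  have e : y + s *: (w - y) = u0 + r *: (y - u0).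
    by apply: plane_eq; rewrite /w /r /= /GRing.scale /=; ring.
  rewrite e in Ox.
  have -> : y = u0 + r^-1 *: ((u0 + r *: (y - u0)) - u0).
    by apply: plane_eq; rewrite /= /GRing.scale /=; field; rewrite gt_eqF.
  apply: (interior_half (interior_subset Ou0) Ox).
  by rewrite invr_gt0 r0 invf_le1.
apply: connectedU => //; last exact: closed_seg_connected.
by exists w; split=> //; exact: closed_segr.
Qed.

Implicit Types a b : plane R.

Lemma seg_inj a b (s t : R) : a != b -> a + s *: (b - a) = a + t *: (b - a) ->
  s = t.
Proof.
move=> ab /addrI/eqP; rewrite -subr_eq0 -scalerBl scaler_eq0 !subr_eq0 eq_sym.
by rewrite [b == a]eq_sym (negPf ab) orbF => /eqP.
Qed.

Lemma open_seg_convex a b : convex (open_seg a b : set (plane R)).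
Proof.
move=> _ _ t [r /= /andP[r0 r1] <-] [s /= /andP[s0 s1] <-] /andP[t0 t1].
exists (r + t * (s - r)); last by apply: plane_eq; rewrite /= /GRing.scale /=; ring.
by apply/andP; have [rs|sr] := leP r s; split; nra.
Qed.

(** * The truncated graph and its faces *)

Section Truncation.
Context (W : set (plane R)).
Hypotheses (openW : open W) (nodesW : nodeset `<=` W).
Hypothesis crossW : forall e, leaving_edge Gamma W e -> exists x,
  e `&` bd W = [set x].
Local Notation G0 := (truncated_graph Gamma W).
Local Notation S0 := (V `&` closure W).

(** [r] may equal [s], whose point can lie on the boundary, but not [u], as [W] is open. *)
Lemma bd_between a b (s u : R) : W (a + u *: (b - a)) -> ~ W (a + s *: (b - a)) ->
  exists2 r, bd W (a + r *: (b - a)) & (s <= r < u) \/ (u < r <= s).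
Proof.
move=> Wu nWs; pose A := closed_seg (a + u *: (b - a)) (a + s *: (b - a)).
have [||||y [[t /= /andP[t0 t1] <-] bdy]] := @connected_meets_bd _ A W.
- exact: closed_seg_connected.
- exact: openW.
- by exists (a + u *: (b - a)); split=> //; exact: closed_segl.
- by move=> /(_ _ (closed_segr _ _)).
have e : a + u *: (b - a) + t *: (a + s *: (b - a) - (a + u *: (b - a))) =
    a + (u + t * (s - u)) *: (b - a).
  by apply: plane_eq; rewrite /= /GRing.scale /=; ring.
rewrite e in bdy; exists (u + t * (s - u)) => //.
have t0' : 0 < t.
  rewrite lt_neqAle t0 andbT; apply/eqP => t00; have [_] := open_bd openW bdy.
  by rewrite -t00 mul0r addr0.
have us : u != s by apply/eqP => e'; apply: nWs; rewrite -e'.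
have [lt|gt|e'] := ltgtP u s; last by rewrite e' eqxx in us.
  by right; apply/andP; split; nra.
by left; apply/andP; split; nra.
Qed.

Lemma closureW_cases x : closure W x -> W x \/ bd W x.
Proof. exact: open_closure_cases. Qed.

Lemma bd_notin x : bd W x -> ~ W x.
Proof. by case/(open_bd openW). Qed.

Lemma bd_in_closure x : bd W x -> closure W x.
Proof. by case. Qed.

(** Oriented form: [x] comes after the crossing at [s0], and [b] is the end on that side. The other
    case follows by exchanging [a] and [b]. *)
Lemma edge_closureW_tail x a b m k (s s0 : R) : a != b ->
  edge_through Gamma x = open_seg a b -> edge_through Gamma x =
    [set y | germ m k y] ->
  edge_through Gamma x `&` bd W = [set a + s0 *: (b - a)] ->
  x = a + s *: (b - a) -> 0 < s < 1 -> ~ closure W x -> s0 < s ->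
  ~ Omega° b /\ closed_seg x b `<=` ~` S0.
Proof.
move=> ab eE gE cr xE /andP[s_0 s_1] nWx s0s.
have crit r : 0 < r < 1 -> bd W (a + r *: (b - a)) -> r = s0.
  move=> r01 bdr; apply: (seg_inj ab).
  suff : [set a + s0 *: (b - a)] (a + r *: (b - a)) by [].
  by rewrite -cr eE; split=> //; exists r.
have nW (u : R) : s <= u <= 1 -> ~ W (a + u *: (b - a)).
  move=> /andP[su u1] Wu.
  have nWs : ~ W (a + s *: (b - a)) by rewrite -xE => /subset_closure.
  have [r bdr h] := bd_between Wu nWs.
  have r01 : 0 < r < 1 by case: h => /andP[? ?]; lra.
  by have := crit r r01 bdr; case: h => /andP[? ?]; lra.
have nOb : ~ Omega° b.
  move=> Ob; have := nodesW (germ_endpoint ab (esym (etrans (esym eE) gE)) Ob).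
  by have := nW 1; rewrite scale1r subrKC; apply; rewrite lexx ltW.
split=> // _ [t /= /andP[t0 t1] <-] [Vy cy].
have e : x + t *: (b - x) = a + (s + t * (1 - s)) *: (b - a).
  by rewrite xE; apply: plane_eq; rewrite /= /GRing.scale /=; ring.
rewrite e in Vy cy; set u := s + _ in Vy cy.
have su : s <= u by rewrite /u lerDl mulr_ge0 // subr_ge0 ltW.
have u1 : u <= 1 by rewrite /u; nra.
have [Wu|bdu] := closureW_cases cy; first by apply: nW Wu; rewrite su.
move: u1; rewrite le_eqVlt => /orP[/eqP u1|u1].
  by apply: nOb; apply: corner_interior; rewrite u1 scale1r subrKC in Vy.
have := crit u _ bdu; rewrite u1 (lt_le_trans s_0 su) => /(_ isT); lra.
Qed.

Lemma edge_leaving_param x a b : V x -> ~ nodeset x -> a != b ->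
  edge_through Gamma x = open_seg a b -> ~ (edge_through Gamma x `<=` closure W) ->
  exists2 s0, 0 < s0 < 1 & edge_through Gamma x `&` bd W = [set a + s0 *: (b - a)].
Proof.
move=> Vx nx ab eE nW.
have [|x0 x0E] := @crossW (edge_through Gamma x).
  by split=> //; split; [exists x|exists a, b].
have : (edge_through Gamma x `&` bd W) x0 by rewrite x0E.
by rewrite eE => -[[s0 /= s01 e] _]; exists s0 => //; rewrite -eE x0E e.
Qed.

Lemma edge_through_refl x : V x -> ~ nodeset x -> edge_through Gamma x x.
Proof. by move=> Vx nx; exact: connected_component_refl. Qed.

(* An edge outside W at some point has left W for good there, so that end of the
   edge is not a vertex and must lie on the boundary of Omega. *)
Lemma outside_tail x : V x -> ~ closure W x -> exists a b,
  [/\ edge_through Gamma x = open_seg a b, ~ Omega° b & closed_seg x b `<=` ~` S0].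
Proof.
move=> Vx nWx.
have nx : ~ nodeset x by move=> /nodesW /subset_closure.
have [m [k [a [b [g ab eE gE]]]]] := edge_structure Vx nx.
have ex := edge_through_refl Vx nx.
have nsub : ~ (edge_through Gamma x `<=` closure W) by move=> /(_ x ex).
have [s0 s001 cr] := edge_leaving_param Vx nx ab eE nsub.
have [s /= s01 xE] : open_seg a b x by rewrite -eE.
have [lt|gt|e] := ltgtP s0 s.
- exists a, b; have [] := edge_closureW_tail ab eE gE cr (esym xE) s01 nWx lt.
  by split.
- exists b, a; rewrite [open_seg b a]open_seg_sym;
  have ba : b != a by rewrite eq_sym.
  have [|||||] := @edge_closureW_tail x b a m k (1 - s) (1 - s0) ba _ gE _ _ _
    nWx _.
  + by rewrite open_seg_sym.
  + by rewrite -seg_sym.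
  + by rewrite -seg_sym.
  + lra.
  + lra.
  + by split.
- exfalso; apply: nWx; apply: bd_in_closure.
  have : (edge_through Gamma x `&` bd W) x by rewrite cr e xE.
  by case.
Qed.

Definition interior_cell m := cell m !=set0 /\ contact m `<=` Omega°.

(** One contact point outside [Omega°] already determines the constant, so [cell m] is not asked to
    be nonempty. *)
Definition boundary_cell m := exists2 z, contact m z & ~ Omega° z.

Lemma interior_or_boundary_cell m : cell m !=set0 -> interior_cell m \/
  boundary_cell m.
Proof.
move=> m0; have [b|nb] := pselect (boundary_cell m);
  [by right|left; split=> // z mz].
by apply: contrapT => nOz; apply: nb; exists z.
Qed.

(** A frontier point is a corner. Were it outside [closure W], its edge would run to the complement
    of [Omega°]; since [m] is one of the gradients of that edge, [contact m] would follow it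
    there. *)
Lemma interior_cell_frontier m x : interior_cell m -> contact m x -> ~ cell m x
  -> S0 x.
Proof.
move=> [m0 mO] mx nmx; have Ox := mO _ mx.
have Vx : V x.
  have [//|[k kx]] := corner_or_cell Ox.
  by exfalso; apply: nmx; rewrite (cell_unique kx mx.2).
split=> //; apply: contrapT => nWx.
have [a [b [eE nOb _]]] := outside_tail Vx nWx.
have nx : ~ nodeset x by move=> /nodesW /subset_closure.
have [k [l [_ [_ [g _ _ gE]]]]] := edge_structure Vx nx.
have sub : open_seg a b `<=` contact m.
  rewrite -eE gE => y [_ /interior_subset Oy ak al _]; split=> //.
  by have [->|->] := germ_cell_mem g (contact_closure m0 mx).
by apply: nOb; apply: mO; apply: contact_closed; apply: closureS sub _ _;
  exact: open_seg_closure.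
Qed.

Lemma cell_notin_support m : cell m `<=` ~` S0.
Proof. by move=> x /cell_not_corner nV [/nV]. Qed.

(** The cell is open, and closed within the component, since its frontier belongs to the truncated
    support. *)
Lemma interior_cell_face m x : interior_cell m -> cell m x ->
  connected_component (~` S0) x = cell m.
Proof.
move=> im mx; apply/seteqP; split; last first.
  apply: connected_component_max => //; first exact: cell_notin_support.
  exact/convex_connected/cell_convex.
set K := connected_component _ _.
have <- : K `&` cell m = K; last exact: subIsetr.
apply: (@component_connected _ (~` S0) x (K `&` cell m)).
- exists x; split=> //; apply: connected_component_refl;
  exact: cell_notin_support mx.
- by exists (cell m) => //; exact: cell_open.
exists (closure (cell m)); first exact: closed_closure.
apply/seteqP; split=> y [Ky my]; split=> //; first exact: subset_closure.
apply: contrapT => nmy.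
have := interior_cell_frontier im (closure_cell my) nmy.
exact: connected_component_sub Ky.
Qed.

Lemma exterior_sub_face x b : closed_seg x b `<=` ~` S0 -> ~ Omega° b ->
  ~` Omega° `<=` connected_component (~` S0) x.
Proof.
move=> sub nOb.
have h : closed_seg x b `|` ~` Omega° `<=` connected_component (~` S0) x.
  apply: connected_component_max; first by left; exact: closed_segl.
    by move=> y [/sub//|nOy] [/corner_interior].
  apply: connectedU; last exact: exterior_connected.
    by exists b; split=> //; exact: closed_segr.
  exact: closed_seg_connected.
by move=> y nOy; apply: h; right.
Qed.

Lemma boundary_cell_face m x : boundary_cell m -> cell m x ->
  ~` Omega° `<=` connected_component (~` S0) x.
Proof.
move=> [z mz nOz] mx; apply: exterior_sub_face (nOz) => _ [t /= /andP[t0 t1] <-].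
move: t1; rewrite le_eqVlt => /orP[/eqP ->|t1].
  by rewrite scale1r subrKC => -[/corner_interior].
apply: (@cell_notin_support m); rewrite seg_sym; apply: contact_half => //.
by rewrite subr_gt0 t1 gerBl.
Qed.

Lemma face_cases x : ~ S0 x -> (exists2 m, interior_cell m & cell m x) \/
  ~` Omega° `<=` connected_component (~` S0) x.
Proof.
move=> nSx; have [Ox|nOx] := pselect (Omega° x); last first.
  right; apply: (@exterior_sub_face x x) => // _ [t _ <-].
  by rewrite subrr scaler0 addr0.
have [Vx|[m mx]] := corner_or_cell Ox.
  have [|a [b [_ nOb sub]]] := @outside_tail x Vx; first by move=> Wx; exact: nSx.
  by right; exact: exterior_sub_face sub nOb.
have [im|bm] := @interior_or_boundary_cell m (ex_intro _ x mx); first by left;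
  exists m.
by right; exact: boundary_cell_face bm mx.
Qed.

Lemma edge_through_truncated_sub x : edge_through G0 x `<=` edge_through Gamma x.
Proof.
have [nA|Ax] := pselect ((support G0 `\` nodes G0) x); last first.
  by rewrite /edge_through [X in X `<=` _]connected_component_out.
apply: connected_component_max; last exact: component_connected.
  exact: connected_component_refl.
move=> y /connected_component_sub[[Vy _] nn]; split=> // ny; apply: nn; by left.
Qed.

(** The crossing becomes a new node and cuts the edge; what remains around [x] is the part before
    the parameter [s0]. *)
Lemma edge_leaving_half x a b (s s0 : R) : V x -> ~ nodeset x -> W x -> a != b ->
  edge_through Gamma x = open_seg a b -> ~ (edge_through Gamma x `<=` closure W) ->
  0 < s0 < 1 -> edge_through Gamma x `&` bd W = [set a + s0 *: (b - a)] ->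
  x = a + s *: (b - a) -> 0 < s < 1 -> s < s0 ->
  a != a + s0 *: (b - a) /\
  edge_through G0 x = open_seg a (a + s0 *: (b - a)).
Proof.
move=> Vx nx Wx ab eE nsub /andP[s00 s01] cr xE /andP[s_0 s_1] ss0.
have crit r : 0 < r < 1 -> bd W (a + r *: (b - a)) -> r = s0.
  move=> r01 bdr; apply: (seg_inj ab).
  suff : [set a + s0 *: (b - a)] (a + r *: (b - a)) by [].
  by rewrite -cr eE; split=> //; exists r.
have inW (u : R) : 0 < u < s0 -> W (a + u *: (b - a)).
  move=> /andP[u0 us]; apply: contrapT => nWu; rewrite xE in Wx.
  have [r bdr h] := bd_between Wx nWu.
  have r01 : 0 < r < 1 by case: h => /andP[? ?]; lra.
  by have := crit r r01 bdr; case: h => /andP[? ?]; lra.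
(* A later point in [closure W] would lie in [W]; with no second crossing, the whole edge would then
   lie in [closure W]. *)
have outW (u : R) : s0 < u < 1 -> ~ closure W (a + u *: (b - a)).
  move=> /andP[su u1] cWu; apply: nsub => y; rewrite eE => -[r /= /andP[r0 r1] <-].
  have u01 : 0 < u < 1 by lra.
  have Wu : W (a + u *: (b - a)).
    by case: (closureW_cases cWu) => // /(crit _ u01) e; move: su; rewrite e ltxx.
  have [rs|sr|->] := ltgtP r s0.
  - by apply: subset_closure; apply: inW; rewrite r0.
  - apply: subset_closure; apply: contrapT => nWr.
    have [t bdt h] := bd_between Wu nWr.
    have t01 : 0 < t < 1 by case: h => /andP[? ?]; lra.
    by have := crit t t01 bdt; case: h => /andP[? ?]; lra.
  - have : [set a + s0 *: (b - a)] (a + s0 *: (b - a)) by [].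
    by rewrite -cr => -[_ /bd_in_closure].
have half (u : R) : 0 < u < s0 -> a + (u / s0) *: (a + s0 *: (b - a) - a) = a +
  u *: (b - a).
  by move=> _; apply: plane_eq; rewrite /= /GRing.scale /=; field; rewrite gt_eqF.
have edge (u : R) : 0 < u < 1 -> edge_through Gamma x (a + u *: (b - a)).
  by move=> u01; rewrite eE; exists u.
have edgeV y : edge_through Gamma x y -> V y /\ ~ nodeset y.
  by move=> /connected_component_sub.
split.
  rewrite eq_sym addrC -subr_eq0 addrK scaler_eq0 subr_eq0 [b == a]eq_sym
    (negPf ab).
  by rewrite gt_eqF.
apply/seteqP; split=> [y ey|].
  have := edge_through_truncated_sub ey; rewrite eE => -[u /= /andP[u0 u1] yE].
  have [[Vy cWy] nny] := connected_component_sub ey.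
  have [us|su|us] := ltgtP u s0.
  - exists (u / s0); last by rewrite half ?u0 // yE.
    by rewrite /= divr_gt0 //= ltr_pdivrMr // mul1r.
  - by exfalso; rewrite -yE in cWy; apply: outW cWy; rewrite su.
  - exfalso; apply: nny; right; have : [set a + s0 *: (b - a)] y by rewrite -yE us.
    rewrite -cr => -[eGy bdy]; split=> //; exists (edge_through Gamma x) => //.
    by split=> //; split; [exists x|exists a, b].
have mem y : open_seg a (a + s0 *: (b - a)) y -> exists2 u,
  0 < u < s0 & y = a + u *: (b - a).
  move=> [t /= /andP[t0 t1] <-]; exists (t * s0).
    by rewrite mulr_gt0 //= -[X in _ < X]mul1r ltr_pM2r.
  by apply: plane_eq; rewrite /= /GRing.scale /=; ring.
apply: connected_component_max; last exact/convex_connected/open_seg_convex.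
  exists (s / s0); last by rewrite half ?s_0 // xE.
  by rewrite /= divr_gt0 //= ltr_pdivrMr // mul1r.
move=> y /mem[u /andP[u0 us] ->].
have Wu : W (a + u *: (b - a)) by apply: inW; rewrite u0.
have /edgeV[Vu nu] : edge_through Gamma x (a + u *: (b - a)) by apply: edge; lra.
split; first by split=> //; exact: subset_closure.
by case=> // -[/bd_notin].
Qed.

Lemma edge_through_truncated x : V x -> ~ nodeset x -> W x -> exists a b,
  a != b /\ edge_through G0 x = open_seg a b.
Proof.
move=> Vx nx Wx; have [m [k [a [b [g ab eE gE]]]]] := edge_structure Vx nx.
have [sub|nsub] := pselect (edge_through Gamma x `<=` closure W).
  exists a, b; split=> //; rewrite -eE; apply/seteqP; split.
    exact: edge_through_truncated_sub.
  apply: connected_component_max; first exact: edge_through_refl.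
    move=> y ey; have [Vy ny] := connected_component_sub ey.
    split; first by split=> //; exact: sub.
    case=> // -[_ [e' [[[z _ e'E] _] nsub]]] e'y; apply: nsub; rewrite e'E in e'y *.
    suff <- : edge_through Gamma x = edge_through Gamma z by [].
    by rewrite /edge_through (same_connected_component ey)
      (same_connected_component e'y).
  exact: component_connected.
have [s0 s001 cr] := edge_leaving_param Vx nx ab eE nsub.
have [s /= s01 xE] : open_seg a b x by rewrite -eE; exact: edge_through_refl.
have [lt|gt|e] := ltgtP s s0.
- have [] := edge_leaving_half Vx nx Wx ab eE nsub s001 cr (esym xE) s01 lt.
  by exists a, (a + s0 *: (b - a)).
- have ba : b != a by rewrite eq_sym.
  have [||||||] := @edge_leaving_half x b a (1 - s) (1 - s0) Vx nx Wx ba _ nsub.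
  + by rewrite open_seg_sym.
  + lra.
  + by rewrite -seg_sym.
  + by rewrite -seg_sym.
  + lra.
  + lra.
  + by exists b, (b + (1 - s0) *: (a - b)).
- exfalso; have : (edge_through Gamma x `&` bd W) x by rewrite cr -e xE.
  by case=> _ /bd_notin.
Qed.

Lemma marked_in_truncated x : V x -> ~ nodeset x -> W x ->
  (support G0 `\` nodes G0) x.
Proof.
move=> Vx nx Wx; split; first by split=> //; exact: subset_closure.
by case=> // -[/bd_notin].
Qed.

Lemma graph_edge_truncated x : V x -> ~ nodeset x -> W x ->
  graph_edge G0 (edge_through G0 x).
Proof.
move=> Vx nx Wx; split; last exact: edge_through_truncated.
by exists x => //; exact: marked_in_truncated.
Qed.

Lemma edge_sides x a b : V x -> ~ nodeset x -> W x ->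
  a != b -> edge_through G0 x = open_seg a b -> exists m k, germ m k x /\
    forall y, edge_through G0 x y -> \forall t \near (0 : R)^'+,
      cell m (y + t *: rot90 (b - a)) /\ cell k (y - t *: rot90 (b - a)).
Proof.
move=> Vx nx Wx ab eE; have [m [k [_ [_ [g _ _ gE]]]]] := edge_structure Vx nx.
have eg y : edge_through G0 x y -> germ m k y.
  by move=> /edge_through_truncated_sub; rewrite gE.
have segg (t : R) : 0 < t < 1 -> germ m k (a + t *: (b - a)).
  by move=> t01; apply: eg; rewrite eE; exists t.
have ba : b - a != 0 by rewrite subr_eq0 eq_sym.
have nba : dot (lat m - lat k) (b - a) = 0.
  (* The parameters 1/3 and 2/3 give two points of the edge; as both pieces agree at both, [b - a]
     is orthogonal to [lat m - lat k]. *)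
  have g1 : germ m k (a + 3^-1 *: (b - a)) by apply: segg; lra.
  have g2 : germ m k (a + (3^-1 + 3^-1) *: (b - a)) by apply: segg; lra.
  have := germ_upperB (3^-1 *: (b - a)) g1.
  rewrite scalerDl addrA in g2; case: g2 => _ _ <- <- _;
    rewrite subrr dotZr => /esym/eqP.
  by rewrite mulf_eq0 invr_eq0 pnatr_eq0 /= => /eqP.
have mk : m != k by case: g.
have := dot_rot90_neq0 (latB_neq0 mk) ba nba; set v := rot90 (b - a).
rewrite neq_lt => /orP[nv|nv].
  exists m, k; split=> // y /eg gy.
  have kv : dot (lat k - lat m) (- v) < 0 by rewrite dotNr -dotNl opprB.
  by apply: filterS2 (germ_side gy nv) (germ_side (germ_sym gy) kv) => t;
    rewrite scalerN.
exists k, m; split=> [|y /eg gy]; first exact: germ_sym.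
have mv : dot (lat m - lat k) (- v) < 0 by rewrite dotNr oppr_lt0.
have kv : dot (lat k - lat m) v < 0 by rewrite -[lat k - _]opprB dotNl oppr_lt0.
by apply: filterS2 (germ_side (germ_sym gy) kv) (germ_side gy mv) => t;
  rewrite scalerN.
Qed.

Lemma component_sub (A B : set (plane R)) x y : connected B -> B `<=` A -> B y ->
  connected_component A x y -> B `<=` connected_component A x.
Proof.
move=> cB BA By cy; rewrite (same_connected_component cy).
exact: connected_component_max.
Qed.

Lemma cell_sub_face f m y : graph_face G0 f -> f y -> cell m y -> cell m `<=` f.
Proof.
move=> [x nSx ->] fy my; apply: component_sub fy => //;
  last exact: cell_notin_support.
exact/convex_connected/cell_convex.
Qed.

Lemma graph_face_eq f g y : graph_face G0 f -> graph_face G0 g -> f y -> g y ->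
  f = g.
Proof.
move=> [x _ ->] [z _ ->] fy gy.
by rewrite (same_connected_component fy) (same_connected_component gy).
Qed.

Lemma cell_face m x : cell m x -> exists f, graph_face G0 f /\ cell m `<=` f.
Proof.
move=> mx; have nS := cell_notin_support mx.
exists (connected_component (~` S0) x); split; first by exists x.
apply: (@cell_sub_face _ m x) => //; first by exists x.
exact: connected_component_refl.
Qed.

Lemma exterior_face : exists f, graph_face G0 f /\ ~` Omega° `<=` f.
Proof.
have [z /bd_polygonE[_ nOz]] := bd_nonempty.
have nSz : ~ S0 z by move=> [/corner_interior].
exists (connected_component (~` S0) z); split; first by exists z.
by apply: (@exterior_sub_face z z) => // _ [t _ <-]; rewrite subrr scaler0 addr0.
Qed.

Lemma graph_face_cases f : graph_face G0 f ->
  (exists2 m, interior_cell m & f = cell m) \/ ~` Omega° `<=` f.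
Proof.
move=> [x nSx ->]; have [[m im mx]|] := face_cases nSx; last by right.
by left; exists m => //; exact: interior_cell_face.
Qed.

(** An interior cell fills its face and leaves no room for another; so two distinct cells share a
    face only by merging into the exterior. *)
Lemma same_face_cells f m k : graph_face G0 f -> cell m !=set0 -> cell k !=set0 ->
  cell m `<=` f -> cell k `<=` f -> m = k \/ (boundary_cell m /\ boundary_cell k).
Proof.
move=> ff [x mx] [y ky] mf kf.
have main l l' z z' : cell l z -> cell l' z' -> cell l `<=` f -> cell l' `<=` f ->
    interior_cell l -> l = l'.
  move=> lz lz' lf lf' il; have e := interior_cell_face il lz.
  have fE : f = cell l.
    by rewrite -e; apply: (graph_face_eq (y := z) ff) => //; [exists z => //;
      exact: cell_notin_support lz|exact: lf|rewrite e].
  have [_ al] : contact l z' by apply: cell_contact; rewrite -fE; exact: lf'.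
  exact: cell_unique lz' al.
have [im|bm] := @interior_or_boundary_cell m (ex_intro _ x mx); first by left;
  exact: main mx ky mf kf im.
have [ik|bk] := @interior_or_boundary_cell k (ex_intro _ y ky); last by right.
by left; symmetry; exact: main ky mx kf mf ik.
Qed.

Lemma boundary_cell_exterior f m : graph_face G0 f -> cell m !=set0 -> cell m
  `<=` f ->
  boundary_cell m -> ~` Omega° `<=` f.
Proof.
move=> [y _ ->] [x mx] mf bm; rewrite (same_connected_component (mf _ mx)).
exact: boundary_cell_face bm mx.
Qed.

Lemma face_sides_cells x f g : V x -> ~ nodeset x -> W x ->
  face_sides G0 (edge_through G0 x) f g ->
  exists m k, [/\ germ m k x, cell m `<=` f & cell k `<=` g].
Proof.
move=> Vx nx Wx [_ ff fg [a [b [ab eE h]]]].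
have [m [k [gx side]]] := edge_sides Vx nx Wx ab eE; exists m, k.
have ex : edge_through G0 x x.
  by apply: connected_component_refl; exact: marked_in_truncated.
have [t [[ft gt] [mt kt]]] : exists t : R,
    (f (x + t *: rot90 (b - a)) /\ g (x - t *: rot90 (b - a))) /\
    (cell m (x + t *: rot90 (b - a)) /\ cell k (x - t *: rot90 (b - a))).
  by apply: (@filter_ex _ (0 : R)^'+); apply: filterS2 (h x ex) (side x ex) => t.
by split=> //; [exact: cell_sub_face ft mt|exact: cell_sub_face gt kt].
Qed.

Lemma face_sides_sym e f g : face_sides G0 e f g -> face_sides G0 e g f.
Proof.
move=> [ee ff fg [a [b [ab eE h]]]]; split=> //; exists b, a; split.
- by rewrite eq_sym.
- by rewrite open_seg_sym.
- move=> x ex; apply: filterS (h x ex) => t.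
  have -> : rot90 (a - b) = - rot90 (b - a).
    by apply: plane_eq; rewrite /rot90 /=; ring.
  by rewrite scalerN opprK => -[].
Qed.

Lemma face_sides_intro x : V x -> ~ nodeset x -> W x ->
  exists m k, germ m k x /\ forall f g, graph_face G0 f -> graph_face G0 g ->
    cell m `<=` f -> cell k `<=` g -> face_sides G0 (edge_through G0 x) f g.
Proof.
move=> Vx nx Wx; have [a [b [ab eE]]] := edge_through_truncated Vx nx Wx.
have [m [k [gx side]]] := edge_sides Vx nx Wx ab eE.
exists m, k; split=> // f g ff fg mf kg; split=> //;
  first exact: graph_edge_truncated.
exists a, b; split=> // y ey; apply: filterS (side y ey) => t [mt kt].
by split; [exact: mf|exact: kg].
Qed.

End Truncation.
End Tropical.

(** * The relaxation is a tropical series *)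

Lemma local_min_form_continuous (F : plane R -> R) x (A : seq lattice)
    (c : lattice -> R) :
  local_min_form F x A c -> {for x, continuous F}.
Proof.
move=> FA; have [Fle [m0 m0A Fx]] := nbhs_singleton FA.
apply/cvgrPdist_lt => eps eps0.
have h : \forall y \near x, forall m, m \in A ->
    0 < eps - dot (lat m) (y - x) /\ 0 < eps + dot (lat m) (y - x).
  apply: near_seq => m mA.
  have h1 : \forall y \near x, 0 < (eps - dot (- lat m) x) + dot (- lat m) y.
    by apply: near_affine_gt0; rewrite subrK.
  have h2 : \forall y \near x, 0 < (eps - dot (lat m) x) + dot (lat m) y.
    by apply: near_affine_gt0; rewrite subrK.
  by apply: filterS2 h1 h2 => y; rewrite !dotNl dotBr; split; lra.
apply: filterS2 FA h => y [Fley [m mA Fy]] hy.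
have := Fley m0 m0A; have := Fle m mA; have := hy m mA; have := hy m0 m0A.
rewrite !dotBr Fx Fy ltr_norml => -[? ?] [? ?] ? ?.
by apply/andP; split; lra.
Qed.

(** Continuity inside comes from the local form; at the boundary [F] is squeezed between 0 and [G],
    which tends to 0. *)
Lemma tropical_intro (F G : plane R -> R) : tropical_series Omega G ->
  (forall x, Omega x -> 0 <= F x) -> (forall x, Omega x -> F x <= G x) ->
  (forall x, Omega° x -> exists (A : seq lattice) c, local_min_form F x A c) ->
  tropical_series Omega F.
Proof.
move=> tG F0 FG FA.
have Fbd x : bd Omega x -> F x = 0.
  move=> bx; have [Ox _] := (bd_polygonE x).1 bx.
  by apply/eqP; rewrite eq_le F0 // andbT -(trop_bd0 tG bx) FG.
split=> //; apply/subspace_continuousP => x Ox.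
have [Oix|bx] : Omega° x \/ bd Omega x.
  by have [|nO] := pselect (Omega° x); [left|right; exact/bd_polygonE].
  have [A [c FAx]] := FA _ Oix.
  exact: cvg_within_filter (local_min_form_continuous FAx).
have := trop_within tG => /subspace_continuousP/(_ x Ox) GC.
apply/cvgrPdist_lt => eps eps0.
have h : \forall y \near within Omega (nbhs x), `|G x - G y| < eps.
  by move/cvgrPdist_lt: GC; apply.
have hO : \forall y \near within Omega (nbhs x), Omega y by exact: withinT.
apply: filterS2 h hO => y.
rewrite /from_subspace (trop_bd0 tG bx) (Fbd _ bx) !sub0r !normrN => h Oy.
by apply: le_lt_trans h; rewrite !ger0_norm ?F0 ?FG // (trop_ge0 tG).
Qed.

Definition int_box (n : nat) : seq int := [seq j%:Z - n%:Z | j <- iota 0 n.*2.+1].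

Lemma mem_int_box n (i : int) : `|i| <= n%:Z -> i \in int_box n.
Proof.
rewrite ler_norml => /andP[i1 i2]; apply/mapP; exists (absz (i + n%:Z)).
  by rewrite mem_iota /=; lia.
by lia.
Qed.

Definition lattice_box n : seq lattice :=
  [seq (i, j) | i <- int_box n, j <- int_box n].

Lemma mem_lattice_box (K : R) (m : lattice) : `|m.1%:~R| <= K -> `|m.2%:~R| <= K ->
  m \in lattice_box (Num.bound K).
Proof.
have box (i : int) : `|i%:~R| <= K -> i \in int_box (Num.bound K).
  move=> iK; apply: mem_int_box; rewrite -(ler_int R) intr_norm.
  apply: (le_trans iK); apply: ltW.
  by rewrite -pmulrn; apply: archi_boundP; rewrite (le_trans _ iK).
case: m => i j /= iK jK; apply/allpairsP; exists (i, j); split=> //=; exact: box.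
Qed.

Section Relaxation.
Context (P : set (plane R)).
Local Notation class :=
  [set G | tropical_series Omega G /\ P `<=` corner_locus Omega G].
Local Notation F := (relaxation Omega P).

Lemma relaxation_le G x : class G -> Omega x -> F x <= G x.
Proof.
move=> CG Ox; apply: ge_inf; last by exists G.
by exists 0 => _ [H [tH _] <-]; exact: trop_ge0 tH _ Ox.
Qed.

(** The infimum over an empty class is 0 by convention, and for the zero function only the gradient
    0 can be active at an interior point. *)
Lemma relaxation_class x : corner_locus Omega F x -> class !=set0.
Proof.
move=> [Ox [A [c [FA [m [k [mA kA mk Fm Fk]]]]]]]; apply: contrapT => C0.
have F0 y : F y = 0.
  rewrite /relaxation (_ : [set _ | _ in _] = set0) ?inf0 //.
  by apply/seteqP; split=> // z [G CG _]; apply: C0; exists G.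
have zero l : l \in A -> F x = c l + dot (lat l) x -> l = 0.
  move=> lA; rewrite F0 => e; apply/eqP; rewrite -(@lat_eq0 R); apply/eqP.
  apply: (@affine_min_cst _ x _ (c l)) => //.
  by apply: filterS FA => y [/(_ l lA)]; rewrite F0.
by move: mk; rewrite (zero m) // (zero k) // eqxx.
Qed.

Hypothesis class_nonempty : class !=set0.

Lemma relaxation_ge (c : R) x : (forall G, class G -> c <= G x) -> c <= F x.
Proof.
move=> h; apply: lb_le_inf; last by move=> _ [G CG <-]; exact: h.
by have [G CG] := class_nonempty; exists (G x), G.
Qed.

Lemma relaxation_approx x (eta : R) : Omega x -> 0 < eta -> exists2 G,
  class G & G x < F x + eta.
Proof.
move=> Ox eta0; have [|_ [G CG <-] lt] := @inf_adherent R
  [set G x | G in class] _ eta0.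
  split; first by have [G CG] := class_nonempty; exists (G x), G.
  by exists 0 => _ [H [tH _] <-]; exact: trop_ge0 tH _ Ox.
by exists G.
Qed.

Lemma relaxation_ge0 x : Omega x -> 0 <= F x.
Proof. by move=> Ox; apply: relaxation_ge => G [tG _]; exact: trop_ge0 tG _ Ox. Qed.

(* The gradients of the competitors near an interior point are bounded by their
   values, hence range over a finite set. *)
Lemma relaxation_local x : Omega° x ->
  exists (A : seq lattice) c, local_min_form F x A c.
Proof.
move=> Ox; have [G0 CG0] := class_nonempty.
have [M M0 hM] := trop_bounded CG0.1.
have [r r0 rO] := near_ball Ox.
pose rho := r / 2; have rho0 : 0 < rho by rewrite divr_gt0.
(* A competitor with value at most [M + 1] at [y] and nonnegative within distance [rho] of [y] has
   active gradients with coordinates at most [K] in absolute value. *)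
pose K := (M + 1) / rho.
pose c m := inf [set upper_const G m | G in class].
exists (lattice_box (Num.bound K)), c.
have cO m y : Omega y -> F y <= c m + dot (lat m) y.
  move=> Oy; rewrite -lerBlDr; apply: lb_le_inf.
    by exists (upper_const G0 m), G0.
  move=> _ [G CG <-]; rewrite lerBlDr (le_trans (relaxation_le CG Oy)) //.
  exact: upper_ge CG.1 _ _ Oy.
have cle G m : class G -> c m <= upper_const G m.
  move=> CG; apply: ge_inf; last by exists G.
  exists (- dot (lat m) x) => _ [H [tH _] <-]; rewrite -subr_ge0 opprK.
  have Ox' := interior_subset Ox.
  exact: le_trans (trop_ge0 tH Ox') (upper_ge tH _ Ox').
have near_rho : \forall y \near x, `|y - x| < rho.
  by apply: (ball_near rho0) => w; rewrite addrC addKr.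
apply: filterS2 near_rho (nbhs_interior Ox) => y yx Oiy;
  have Oy := interior_subset Oiy.
split=> [m _|]; first exact: cO.
apply: contrapT => nm.
have box0 : (0 : lattice) \in lattice_box (Num.bound K).
  have K0 : 0 <= K by rewrite divr_ge0 ?addr_ge0 // ltW.
  by apply: mem_lattice_box; rewrite /= normr0.
have [m0 m0A m0min] := seq_argmin (fun m => c m + dot (lat m) y) box0.
pose gap := c m0 + dot (lat m0) y - F y.
have gap0 : 0 < gap.
  rewrite subr_gt0 lt_neqAle cO // andbT; apply/eqP => e; apply: nm; by exists m0.
(* The bound [gap] lets the active piece of [G] undercut the best piece of the box; the bound 1
   gives [G y <= M + 1], which puts that piece in the box. *)
have [|G CG Gy] := @relaxation_approx y (Num.min gap 1) Oy.
  by rewrite lt_min gap0 ltr01.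
have [m am] := ex_active CG.1 Oiy.
have GM : G y <= M + 1.
  apply: (le_trans (ltW Gy)); apply: lerD; last by rewrite ge_min lexx orbT.
  exact: le_trans (relaxation_le CG0 Oy) (hM _ Oy).
have grad v : `|v| <= rho -> - dot (lat m) v <= M + 1.
  move=> vr; have Oyv : Omega (y + v).
    have -> : y + v = x + ((y - x) + v) by rewrite addrA subrKC.
    apply: rO; apply: le_lt_trans (ler_normD _ _) _.
    by rewrite [r]splitr ltr_leD.
  have := trop_ge0 CG.1 Oyv; have := upper_ge CG.1 m Oyv.
  by move: am GM; rewrite /active /upper dotDr; lra.
have bound (i : int) (v : plane R) : `|v| <= rho -> dot (lat m) v = i%:~R * rho ->
    `|i%:~R| <= K.
  move=> vr e; rewrite ler_pdivlMr // -[rho in leLHS](gtr0_norm rho0) -normrM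
    -e ler_norml.
  have := grad v vr; have := grad (- v); rewrite normrN dotNr => /(_ vr); lra.
have mA : m \in lattice_box (Num.bound K).
  apply: mem_lattice_box.
    apply: (bound m.1 (rho, 0)); last by rewrite /dot /= mulr0 addr0.
    by rewrite prod_normE /= normr0 gtr0_norm // ge_max lexx ltW.
  apply: (bound m.2 (0, rho)); last by rewrite /dot /= mulr0 add0r.
  by rewrite prod_normE /= normr0 gtr0_norm // ge_max lexx ltW.
have := m0min m mA; have := cle G m CG.
have : G y < F y + gap by apply: (lt_le_trans Gy); rewrite lerD2l ge_min lexx.
by move: am; rewrite /active /upper /gap; lra.
Qed.

Lemma relaxation_tropical : tropical_series Omega F.
Proof.
have [G0 CG0] := class_nonempty; apply: (tropical_intro CG0.1).
- exact: relaxation_ge0.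
- by move=> x Ox; exact: relaxation_le.
- exact: relaxation_local.
Qed.

End Relaxation.

(** * Perturbation of the marked points *)

(** Maximality: the affine function of a larger linearity domain agrees with the piece [m] near a
    point of the cell, hence everywhere. *)
Lemma cell_face_cell (F : plane R -> R) m : tropical_series Omega F -> cell F m
  !=set0 ->
  face_cell Omega F (cell F m).
Proof.
move=> tF [u mu]; split.
  split; [exact: cell_open|exact/convex_connected/cell_convex|by exists
    u|exact: cell_interior|].
  by exists (lat m), (upper_const F m) => x /cell_contact[].
move=> U' [oU _ _ UO [q [c Fq]]] sub; apply/seteqP; split=> // x Ux.
have near_u : \forall y \near u, upper F m y = c + dot q y.
  apply: filterS (nbhs_interior mu) => y my; rewrite -Fq; last exact: sub.
  by have [_ ->] := cell_contact my.
have Fu := nbhs_singleton near_u; rewrite /upper in Fu.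
have /eqP : lat m - q = 0.
  apply: (@affine_min_cst _ u _ (upper_const F m - c)); last by rewrite dotBl; lra.
  by apply: filterS near_u => y; rewrite /upper dotBl; lra.
rewrite subr_eq0 => /eqP qE; rewrite -qE in Fq Fu.
have cE : upper_const F m = c by lra.
apply: cell_intro; first exact: UO.
by apply: filterS (open_nbhs_nbhs (conj oU Ux)) => y /Fq; rewrite /active /upper cE.
Qed.

Lemma side_not_interior S w : polygon_side Omega S -> S w -> ~ Omega° w.
Proof.
move=> [n [a [n0 Osub -> _]]] [Ow /= nw] Oiw; move/negP: n0; apply; apply/eqP.
apply: (@affine_min_cst _ w _ a); last by rewrite addrC.
by apply: filterS Oiw => y /Osub /=; rewrite addrC.
Qed.

Lemma vertex_not_interior w : polygon_vertex Omega w -> ~ Omega° w.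
Proof.
move=> [Ow vw] Oiw; have [r [r0 _ O1 O2]] := near_line_sym (1, 0) Oiw ltr01.
have : open_seg (w + r *: (1, 0)) (w + (- r) *: (1, 0)) w.
  exists 2^-1; first by rewrite /= invr_gt0 ltr0n invf_lt1 ?ltr1n.
  by apply: plane_eq; rewrite /= /GRing.scale /=; field.
move=> /(vw _ _ O1 O2)/addrI/(congr1 fst) /=; rewrite /GRing.scale /=; lra.
Qed.

(** Some constraint is tight at [z]. If [z] is not extreme, it lies strictly inside a segment of
    [Omega]; the constraint vanishes at both ends too, giving the two points a side must have. The
    marked type records boundary contact only through sides and vertices. *)
Lemma bd_side_or_vertex z : bd Omega z ->
  polygon_vertex Omega z \/ exists2 S, polygon_side Omega S & S z.
Proof.
move=> /bd_polygonE[Oz nOz]; case: polyO => [[s [n [a [npr OE]]]] _ _].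
have [r rz] : exists r, dot (lat (n r)) z + a r = 0.
  apply: contrapT => nr; apply: nOz.
  have h : \forall y \near z, forall r,
    r \in enum 'I_s -> 0 < a r + dot (lat (n r)) y.
    apply: near_seq => r _; apply: near_affine_gt0.
    have : Omega z by []. rewrite OE => /(_ r);
      rewrite le_eqVlt addrC => /orP[/eqP e|//].
    by exfalso; apply: nr; exists r; rewrite addrC.
  apply: filterS h => y h; rewrite OE => r; rewrite addrC ltW // h //;
    exact: mem_enum.
have [v|nv] := pselect (polygon_vertex Omega z); [by left|right].
have [x [y [Ox Oy zxy xy]]] : exists x y,
  [/\ Omega x, Omega y, open_seg x y z & x != y].
  apply: contrapT => h; apply: nv; split=> // x y Ox Oy zxy;
    apply/eqP/negPn/negP => xy.
  by apply: h; exists x, y.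
have pos w : Omega w -> 0 <= dot (lat (n r)) w + a r by rewrite {1}OE; exact.
exists (Omega `&` [set x | dot (lat (n r)) x + a r = 0]); last by [].
exists (lat (n r)), (a r); split=> //; first last.
- have [t /= /andP[t0 t1] e] := zxy.
  have := pos x Ox; have := pos y Oy; move: rz;
    rewrite -e segE dotDr !dotZr => h hy hx.
  exists x, y; split=> //; split=> //=; nra.
- by rewrite lat_eq0; apply: contraTneq (npr r) => ->.
Qed.

(** At the contact point [z] of [F] one has [upper F m z = 0 <= F' z <= upper F' m z]; exchanging
    the roles gives equality of the constants. *)
Lemma boundary_upper_const (F F' : plane R -> R) m :
  tropical_series Omega F -> tropical_series Omega F' ->
  boundary_cell F m -> boundary_cell F' m -> upper_const F m = upper_const F' m.
Proof.
move=> tF tF' [z [Oz az] nz] [z' [Oz' az'] nz'].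
have Fz := trop_bd0 tF (proj2 (bd_polygonE z) (conj Oz nz)).
have Fz' := trop_bd0 tF' (proj2 (bd_polygonE z') (conj Oz' nz')).
have := le_trans (trop_ge0 tF Oz') (upper_ge tF m Oz').
have := le_trans (trop_ge0 tF' Oz) (upper_ge tF' m Oz).
by move: az az'; rewrite /active Fz Fz' /upper; lra.
Qed.

Section Perturbation.
Context (N : nat) (p p' : 'I_N -> plane R).
Local Notation F := (relaxation Omega (range p)).
Local Notation F' := (relaxation Omega (range p')).
Hypothesis tropF : tropical_series Omega F.
Hypothesis p_edge : forall i, exists2 e, face_edge Omega F e & e (p i).
Hypothesis type_eq : same_marked_type Omega p p'.

(* Moving the marked points changes the constant term of each affine piece
   (none for the pieces reaching the boundary, where the value is prescribed),
   and the incidence of p i with an edge prescribes the difference of the two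
   changes. *)
Lemma constant_shift (i0 : 'I_N) : exists delta : lattice -> R,
  (forall m, cell F m !=set0 -> boundary_cell F m -> delta m = 0) /\
  forall i m k, germ F m k (p i) ->
    delta m - delta k = dot (lat k - lat m) (p' i - p i).
Proof.
have [phi [[[phiF _ _] kind le _] grad _ bnd mark]] := type_eq.
have edge' i : exists e, [/\ face_edge Omega F e, e (p i),
    face_edge Omega F' (phi e) & phi e (p' i)].
  have [e Fe ep] := p_edge i; exists e.
  have fe : face Omega F e by left; right.
  have [_ [Fe' _] _] := kind e fe; have [m' _] := mark i e fe.
  by split=> //; [exact: Fe'|exact: m'].
have edgeV (H : plane R -> R) e y : face_edge Omega H e -> e y ->
    corner_locus Omega H y /\ ~ tropical_vertex Omega H y.
  by move=> [[x _ ->] _] /connected_component_sub.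
have tropF' : tropical_series Omega F'.
  have [e [_ _ Fe' pe']] := edge' i0; apply: relaxation_tropical.
  exact: relaxation_class (edgeV _ _ _ Fe' pe').1.
(* [phi] preserves gradients, so [F'] is affine of gradient [m] on the open set [phi (cell F m)];
   its constant there must be the global one. *)
have cell' m : cell F m !=set0 -> phi (cell F m) `<=` cell F' m.
  move=> m0; have fc := cell_face_cell tropF m0.
  have ff : face Omega F (cell F m) by left; left.
  have [[fc' _] _ _] := kind _ ff; have {fc'} [[oU _ _ UO _] _] := fc' fc.
  have [gr _] := grad _ m fc; have [c Fc] : has_gradient F' (phi (cell F m)) m.
    by apply: gr; exists (upper_const F m) => x /cell_contact[].
  move=> x Ux; have xU := open_nbhs_nbhs (conj oU Ux).
  have Oix := UO x Ux.
  have cE : upper_const F' m = c.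
    by apply: (upper_near tropF' Oix); apply: filterS xU => y /Fc.
  by apply: cell_intro => //; apply: filterS xU => y /Fc; rewrite /active /upper cE.
exists (fun m => upper_const F' m - upper_const F m); split=> [m m0 bm|i m k g].
  apply/eqP; rewrite subr_eq0; apply/eqP;
    apply: (boundary_upper_const tropF' tropF) => //.
  have ff : face Omega F (cell F m) by left; left; exact: cell_face_cell.
  have [z mz nz] := bm.
  have cz := contact_closure tropF m0 mz.
  have bz : bd Omega z by apply/bd_polygonE; split=> //; case: mz.
  have [bS _ bv] := bnd _ ff.
  have fin w : closure (phi (cell F m)) w -> ~ Omega° w -> boundary_cell F' m.
    move=> cw nw; exists w => //; apply: (closure_cell tropF').
    exact: closureS (cell' m m0) _ cw.
  have [v|[S sS Sz]] := bd_side_or_vertex bz.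
    by apply: (fin z); [exact/(bv z v)|exact: vertex_not_interior].
  have [w [cw Sw]] : closure (phi (cell F m)) `&` S !=set0 by apply/(bS S sS);
    exists z.
  by apply: (fin w) => //; exact: side_not_interior Sw.
have [e [Fe pe Fe' pe']] := edge' i.
have [Ve _] := edgeV _ _ _ Fe' pe'.
(* The edge lies in the closure of [cell F l]. This relation passes through [phi], so the moved
   point lies in the closure of [cell F' l], where the piece [l] is active. *)
have act l l' : germ F l l' (p i) -> active F' (p' i) l.
  move=> gl; have l0 : cell F l !=set0.
    have [u [lu _]] := germ_closure tropF gl filterT; by exists u.
  have eE : e = [set y | germ F l l' y].
    have [[x xV ex] _] := Fe; rewrite -(edge_through_germ tropF gl) ex.
    rewrite /edge_through; apply: same_connected_component; by rewrite ex in pe.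
  have lef : face_le e (cell F l).
    rewrite /face_le [X in _ `<=` X](iffLR (closure_id _)
      (@closed_closure _ (cell F l))).
    by apply: closureS; rewrite eE => y /(germ_closure tropF).
  have fe : face Omega F e by left; right.
  have ff : face Omega F (cell F l) by left; left; exact: cell_face_cell.
  have /(le _ _ fe ff) lef' := lef.
  have cl : closure (cell F' l) (p' i).
    by apply: closureS (cell' l l0) _ _; apply: lef'; exact: subset_closure.
  by case: (closure_cell tropF' cl).
have am := act m k g; have ak := act k m (germ_sym g).
case: g => _ _; move: am ak;
  rewrite /active /upper dotBl !dotBr => -> h1 h2 h3 _; lra.
Qed.

End Perturbation.

(** * The spanning tree *)

Section Tree.
Context (N : nat) (p : 'I_N -> plane R) (i0 : 'I_N).
Local Notation F := (relaxation Omega (range p)).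
Local Notation Gamma := (tropical_graph Omega F).
Hypothesis gen : strongly_generic Omega p.

Lemma marked_edge i : exists2 e, face_edge Omega F e & e (p i).
Proof. by case: gen. Qed.

Lemma marked_corner i : corner_locus Omega F (p i).
Proof. by have [e [[x _ ->] _] /connected_component_sub[]] := marked_edge i. Qed.

Lemma marked_not_vertex i : ~ tropical_vertex Omega F (p i).
Proof. by have [e [[x _ ->] _] /connected_component_sub[]] := marked_edge i. Qed.

Lemma generic_tropical : tropical_series Omega F.
Proof. exact: relaxation_tropical (relaxation_class (marked_corner i0)). Qed.

Local Notation tropF := generic_tropical.

Context (W : set (plane R)).
Hypotheses (openW : open W) (nodesW : tropical_vertex Omega F `<=` W).
Hypothesis crossW : forall e, leaving_edge Gamma W e -> exists x,
  e `&` bd W = [set x].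
Hypothesis pW : forall i, W (p i).
Local Notation G0 := (truncated_graph Gamma W).
Local Notation edge i := (edge_through G0 (p i)).

(** An edge of the truncated graph lies within an edge of [Gamma], and genericity puts distinct
    marked points on distinct edges there. *)
Lemma marked_edge_inj : injective (fun i => edge i).
Proof.
move=> i j e; have [_ _ + _] := gen; apply.
- split; first by exists (p i) => //; split;
  [exact: marked_corner|exact: marked_not_vertex].
  have [_ [_ [a [b [_ ab eE _]]]]] := edge_structure tropF (marked_corner i)
    (@marked_not_vertex i).
  by exists a, b.
- by apply: connected_component_refl; split;
  [exact: marked_corner|exact: marked_not_vertex].
- apply: (@edge_through_truncated_sub F W); rewrite e;
  apply: connected_component_refl.
  by apply: marked_in_truncated => //;
    [exact: marked_corner|exact: marked_not_vertex].
Qed.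

Lemma germ_cells_nonempty m k x : germ F m k x -> cell F m !=set0 /\ cell F k
  !=set0.
Proof.
move=> g; have [u [mu _]] := germ_closure tropF g filterT.
have [w [kw _]] := germ_closure tropF (germ_sym g) filterT.
by split; [exists u|exists w].
Qed.

Lemma marked_edges_acyclic n (v ee : nat -> set (plane R)) :
  ~ mg_cycle (planar_dual G0) (range (fun i => edge i)) n v ee.
Proof.
move=> [n0 _ einj cyc].
have /choice[t ht] : forall j, exists t : 'I_N * (lattice * lattice), (j < n)%N ->
    [/\ ee j = edge t.1, germ F t.2.1 t.2.2 (p t.1),
        cell F t.2.1 `<=` v j & cell F t.2.2 `<=` v (j.+1 %% n)%N].
  move=> j; have [lt|ge] := ltnP j n; last by exists (i0, (0, 0)).
  have [[i _ ie] ends] := cyc j lt; rewrite -ie in ends.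
  have [m [k [g mf kf]]] := face_sides_cells tropF openW (marked_corner i)
    (@marked_not_vertex i) (pW i) ends.
  by exists (i, (m, k)).
have facev j : (j < n)%N -> graph_face G0 (v j) by move=> /cyc[_ []].
set s := fun j => (t j).1; set m := fun j => (t j).2.1; set k := fun j => (t j).2.2.
have [_ _ _ [eps eps0 stab]] := gen.
(* Moving the first marked point along the gradient jump [w] changes its equation by [r * dot w w],
   which is nonzero; with this [r] the displacement has norm [eps / 2]. *)
pose w : plane R := lat (k 0%N) - lat (m 0%N).
have w0 : w != 0.
  apply: latB_neq0; have [_ [mk _ _ _ _] _ _] := ht 0%N n0.
  by rewrite eq_sym.
pose r := eps / 2 / `|w|.
have nw0 : 0 < `|w| by rewrite normr_gt0.
have r0 : 0 < r by rewrite !divr_gt0.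
pose p' i := p i + (if i == s 0%N then r *: w else 0).
have [|delta [d0 dE]] := @constant_shift N p p' tropF marked_edge _ i0.
  apply: stab => i; rewrite /p' addrC addKr; case: ifP => _; last by rewrite normr0.
  rewrite normrZ gtr0_norm // /r divfK ?gt_eqF //; lra.
(* Consecutive edges of the cycle share a face, so the two gradients coincide or both cells reach
   the boundary, where [delta] vanishes. *)
have next j : (j < n)%N -> delta (k j) = delta (m (j.+1 %% n)%N).
  move=> lt; have lt' : (j.+1 %% n < n)%N by rewrite ltn_pmod.
  have [_ g _ kf] := ht j lt; have [_ g' mf _] := ht _ lt'.
  have [_ k0] := germ_cells_nonempty g; have [m0 _] := germ_cells_nonempty g'.
  rewrite /k /m; have [->//|[bk bm]] := same_face_cells tropF openW nodesW
    crossW (facev _ lt') k0 m0 kf mf.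
  by rewrite (d0 _ k0 bk) (d0 _ m0 bm).
(* The edges of the cycle are distinct, so only the point on edge 0 has moved. *)
have step j : (j < n)%N -> (0 < j)%N -> delta (m j) = delta (k j).
  move=> lt j0; have [eE g _ _] := ht j lt; have := dE _ _ _ g.
  have [eE0 _ _ _] := ht 0%N n0.
  have /negPf ne : s j != s 0%N.
    apply/eqP => e; have : j = 0%N.
      by apply: einj; rewrite ?inE // eE eE0 -/(s j) e.
    by move=> j00; rewrite j00 in j0.
  by rewrite /p' -/(s j) ne addr0 subrr dotC /dot /= !mul0r addr0 => /eqP;
    rewrite subr_eq0 => /eqP.
have all j : (j < n)%N -> delta (k j) = delta (k 0%N).
  elim: j => // j IH lt; rewrite -(step _ lt) // -(IH (ltnW lt)) next ?(ltnW lt) //.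
  by rewrite modn_small.
have last : delta (k 0%N) = delta (m 0%N).
  have lt : (n.-1 < n)%N by rewrite prednK.
  by rewrite -(all _ lt) next // prednK // modnn.
have [_ g _ _] := ht 0%N n0; have := dE _ _ _ g.
rewrite -/(m 0%N) -/(k 0%N) -/(s 0%N) last subrr /p' eqxx [p _ + _]addrC addrK
  dotZr -/w => /esym/eqP.
by rewrite mulf_eq0 !gt_eqF // dot_gt0.
Qed.

(** As [F] is the minimum of its pieces, taking the minimum with the shifted pieces of [K] amounts
    to lowering their constants by [eps], without listing the other pieces. *)
Definition lowered (K : seq lattice) (eps : R) x : R :=
  foldr (fun l s => Num.min (upper F l x - eps) s) (F x) K.

Lemma lowered_le K eps x : lowered K eps x <= F x.
Proof. by elim: K => //= l K IH; rewrite ge_min IH orbT. Qed.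

Lemma lowered_le_upper K eps x l : l \in K -> lowered K eps x <= upper F l x - eps.
Proof.
elim: K => //= j K IH; rewrite inE ge_min => /orP[/eqP->|/IH ->];
  last by rewrite orbT.
by rewrite lexx.
Qed.

Lemma lowered_ge K eps x (c : R) : c <= F x ->
  (forall l, l \in K -> c <= upper F l x - eps) -> c <= lowered K eps x.
Proof.
move=> cF; elim: K => //= j K IH h; rewrite le_min h ?mem_head //=.
by apply: IH => l lK; apply: h; rewrite inE lK orbT.
Qed.

Lemma lowered_cases K eps x : lowered K eps x = F x \/
  exists2 l, l \in K & lowered K eps x = upper F l x - eps.
Proof.
elim: K => [|j K IH] /=; first by left.
rewrite minElt; case: ifP => _; first by right; exists j; rewrite ?mem_head.
case: IH => [->|[l lK ->]]; first by left.
by right; exists l; rewrite // inE lK orbT.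
Qed.

Lemma lowered_tropical K (eps : R) : 0 < eps ->
  (forall l, l \in K -> forall x, Omega x -> eps <= upper F l x) ->
  tropical_series Omega (lowered K eps).
Proof.
move=> eps0 Kpos; apply: (tropical_intro tropF).
- move=> x Ox; apply: lowered_ge; first exact: trop_ge0 tropF _ Ox.
  by move=> l lK; rewrite subr_ge0 Kpos.
- by move=> x _; exact: lowered_le.
move=> x Ox; have [A [aA FA]] := local_active tropF Ox.
exists (A ++ K), (fun m =>
  if m \in K then upper_const F m - eps else upper_const F m).
apply: filterS2 (nbhs_interior Ox) FA => y /interior_subset Oy [m mA am].
have shift l : upper_const F l - eps + dot (lat l) y = upper F l y - eps.
  by rewrite /upper; lra.
split=> [l _|].
  case: ifP => lK; first by rewrite shift lowered_le_upper.
  exact: le_trans (lowered_le _ _ _) (upper_ge tropF l Oy).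
have [e|[l lK e]] := lowered_cases K eps y; last first.
  by exists l; rewrite ?mem_cat ?lK ?orbT // shift.
exists m; first by rewrite mem_cat mA.
case: ifP => mK; last by rewrite e am.
by have := lowered_le_upper eps y mK; rewrite e am; lra.
Qed.

(** Near [x] some piece of [K] is always active, so the lowered function is [F - eps] there and
    keeps the corner. *)
Lemma lowered_corner_in K (eps : R) m k x : 0 < eps -> germ F m k x ->
  m \in K -> k \in K -> corner_locus Omega (lowered K eps) x.
Proof.
move=> eps0 [mk Ox am ak h] mK kK.
have lowE y l : Omega y -> l \in K -> active F y l -> lowered K eps y = upper F
  l y - eps.
  move=> Oy lK al; apply/eqP; rewrite eq_le lowered_le_upper //=; apply: lowered_ge.
    by rewrite -al gerBl ltW.
  by move=> j _; rewrite lerD2r -al; exact: (upper_ge tropF j Oy).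
have shift l y : upper_const F l - eps + dot (lat l) y = upper F l y - eps.
  by rewrite /upper; lra.
have Ox' := interior_subset Ox.
split=> //; exists [:: m; k], (fun l => upper_const F l - eps); split.
  apply: filterS2 (nbhs_interior Ox) h => y /interior_subset Oy amk; split=> [l|].
    by rewrite !inE shift => /orP[/eqP->|/eqP->]; exact: lowered_le_upper.
  by case: amk => [a|a]; [exists m|exists k]; rewrite ?inE ?eqxx ?orbT // shift;
    exact: lowE.
by exists m, k; split; rewrite ?inE ?eqxx ?orbT // shift; exact: lowE.
Qed.

(** The pieces of [K] exceed [F] by more than [eps] at [x], hence near [x], where the lowered
    function is still [F]. *)
Lemma lowered_corner_out K (eps : R) m x : corner_locus Omega F x -> active F x m ->
  0 < eps -> (forall l, l \in K -> eps < upper F l x - F x) ->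
  corner_locus Omega (lowered K eps) x.
Proof.
move=> Vx am eps0 gap; have Ox := corner_interior Vx.
have low : \forall y \near x, lowered K eps y = F y.
  have h : \forall y \near x, forall l, l \in K ->
      0 < upper_const F l - upper_const F m - eps + dot (lat l - lat m) y.
    apply: near_seq => l lK; apply: near_affine_gt0.
    by have := gap l lK; rewrite am /upper dotBl; lra.
  apply: filterS2 (nbhs_interior Ox) h => y /interior_subset Oy hy.
  apply/eqP; rewrite eq_le lowered_le /=; apply: lowered_ge => // l lK.
  have := upper_ge tropF m Oy; have := hy l lK; rewrite /upper dotBl; lra.
case: Vx => _ [A [c [FA [j [l [jA lA jl Fj Fl]]]]]]; split=> //.
exists A, c; split; last by exists j, l; rewrite (nbhs_singleton low).
by apply: filterS2 low FA => y -> .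
Qed.

(** If the minimum over [Omega] were 0, it would be attained at a contact point, hence inside
    [Omega°]. The piece would then be the zero function, and boundary points would be contact points
    as well. *)
Lemma interior_upper_pos l : interior_cell F l ->
  exists2 d : R, 0 < d & forall x, Omega x -> d <= upper F l x.
Proof.
move=> [_ lO]; case: polyO => _ cO [u /interior_subset Ou].
have [||z zO zmin] := @compact_EVT_min _ R (upper F l) Omega _ cO.
- by exists u.
- by apply: continuous_subspaceT => x; exact: affine_continuous.
rewrite inE in zO; exists (upper F l z); last by move=> x Ox; apply: zmin;
  rewrite inE.
have pos x : Omega x -> 0 <= upper F l x.
  by move=> Ox; exact: le_trans (trop_ge0 tropF Ox) (upper_ge tropF l Ox).
rewrite lt_neqAle pos // andbT; apply/eqP => z0.
have Oiz : Omega° z.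
  apply: lO; split=> //; apply/eqP; rewrite /active eq_le (upper_ge tropF) //= -z0.
  exact: trop_ge0 tropF _ zO.
have l0 : lat l = 0 :> plane R.
  by apply: (@affine_min_cst _ z _ (upper_const F l)); [apply: filterS Oiz|].
have [w bw] := bd_nonempty; have [Ow nw] := (bd_polygonE w).1 bw.
apply: nw; apply: lO; split=> //; rewrite /active (trop_bd0 tropF bw).
by move: z0; rewrite /upper l0 /dot /= !mul0r.
Qed.

Lemma eventually_small (T : eqType) (s : seq T) (Q : T -> R -> Prop) :
  (forall l, l \in s -> exists2 d : R, 0 < d & forall e, 0 < e <= d -> Q l e) ->
  exists2 d : R, 0 < d & forall e, 0 < e <= d -> forall l, l \in s -> Q l e.
Proof.
elim: s => [|a s IH] h; first by exists 1.
have [d1 d10 h1] := h a (mem_head _ _).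
have [|d2 d20 h2] := IH; first by move=> l ls; apply: h; rewrite inE ls orbT.
exists (Num.min d1 d2); first by rewrite lt_min d10.
move=> e /andP[e0]; rewrite le_min => /andP[e1 e2] l; rewrite inE => /orP[/eqP->|].
  by apply: h1; rewrite e0.
by apply: h2; rewrite e0.
Qed.

Local Notation dual := (planar_dual G0).
Local Notation marked_edges := (range (fun i => edge i)).

(* The cells from which the exterior cannot be reached across marked edges may
   be lowered together by a small constant, keeping every marked point on the
   corner locus; this contradicts the minimality of F. *)
Lemma exterior_reaches ext h : graph_face G0 ext -> ~` Omega° `<=` ext ->
  graph_face G0 h -> mg_walk dual marked_edges ext h.
Proof.
move=> extf extO hf; pose reach f := mg_walk dual marked_edges ext f.
have [z /bd_polygonE[_ nOz]] := bd_nonempty.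
have ext_reach f : graph_face G0 f -> ~` Omega° `<=` f -> reach f.
  move=> ff fO; have -> : f = ext by apply: (graph_face_eq (y := z) ff extf);
    [exact: fO|exact: extO].
  exact: (mg_walk_refl _ _ (edge i0)).
apply: contrapT => nh.
have [[m0 im0 hE]|] := graph_face_cases tropF openW nodesW crossW hf; last first.
  by move=> /(ext_reach _ hf).
have /choice[t ht] : forall i, exists t : lattice * lattice, germ F t.1 t.2 (p i) /\
    forall f g, graph_face G0 f -> graph_face G0 g -> cell F t.1 `<=` f ->
    cell F t.2 `<=` g -> face_sides G0 (edge i) f g.
  move=> i; have [m [k mkh]] := face_sides_intro tropF openW crossW
    (marked_corner i) (@marked_not_vertex i) (pW i).
  by exists (m, k).
pose bad m := cell F m !=set0 /\
  forall f, graph_face G0 f -> cell F m `<=` f -> ~ reach f.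
have bad_interior m : bad m -> interior_cell F m.
  move=> [m1 bm]; have [//|bd] := interior_or_boundary_cell m1.
  have [u mu] := m1; have [f [ff mf]] := cell_face tropF W mu.
  by exfalso; apply: (bm f ff mf); apply: ext_reach => //;
    exact: (boundary_cell_exterior tropF ff m1 mf bd).
(* A walk reaching the face on one side of a marked edge extends across it. *)
have bad_sym i : bad (t i).1 <-> bad (t i).2.
  have [gi si] := ht i; have [n1 n2] := germ_cells_nonempty gi.
  have [u1 c1] := n1; have [u2 c2] := n2.
  have [f1 [ff1 s1]] := cell_face tropF W c1;
    have [f2 [ff2 s2]] := cell_face tropF W c2.
  have ri : marked_edges (edge i) by exists i.
  split=> -[_ b]; split=> // f ff sf rf.
    by apply: (b f1 ff1 s1); apply: (mg_walk_step rf ri);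
      apply: face_sides_sym; exact: si.
  by apply: (b f2 ff2 s2); apply: (mg_walk_step rf ri); exact: si.
(* A finite list is enough: [m0], where the contradiction is read off, and the bad gradients beside
   marked points, so that both sides of a marked edge are lowered or neither. *)
pose K := [seq l <- m0 :: flatten [seq [:: (t i).1; (t i).2] | i <- enum 'I_N]
  | `[< bad l >]].
have Kbad l : l \in K -> bad l by rewrite mem_filter => /andP[/asboolP].
have Kmem i l : l = (t i).1 \/ l = (t i).2 -> bad l -> l \in K.
  move=> e bl; rewrite mem_filter; apply/andP; split; first exact/asboolP.
  rewrite inE; apply/orP; right; apply/flattenP; exists [:: (t i).1; (t i).2].
    by apply: map_f; rewrite mem_enum.
  by rewrite !inE; case: e => ->; rewrite eqxx ?orbT.
have Km0 : m0 \in K.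
  rewrite mem_filter mem_head andbT; apply/asboolP.
  have [u mu] := im0.1; split; first by exists u.
  move=> f ff mf; suff -> : f = h by [].
  by apply: (graph_face_eq (y := u) ff hf); [exact: mf|rewrite hE].
pose Q l (e : R) := (forall x, Omega x -> e <= upper F l x) /\
  forall i, i \in enum 'I_N -> ~ bad (t i).1 -> e < upper F l (p i) - F (p i).
have [l lK|d d0 hd] := @eventually_small _ K Q.
  have [d1 d10 h1] := interior_upper_pos (bad_interior l (Kbad l lK)).
  pose Q' i (e : R) := ~ bad (t i).1 -> e < upper F l (p i) - F (p i).
  have [i _|d2 d20 h2] := @eventually_small _ (enum 'I_N) Q'.
    have [bi|nbi] := pselect (bad (t i).1); first by exists 1 => // e _ [].
    have Op := interior_subset (corner_interior (marked_corner i)).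
    have gap : 0 < upper F l (p i) - F (p i).
      (* If a piece of [K] were active at [p i], its cell would touch [p i], so its gradient would
         be one of the two of the germ, and that side would be bad. *)
      rewrite subr_gt0 lt_neqAle (upper_ge tropF) // andbT; apply/eqP => al.
      have [gi _] := ht i.
      have cl : closure (cell F l) (p i)
        by exact: (contact_closure tropF (Kbad l lK).1 (conj Op al)).
      have [e|e] := germ_cell_mem tropF gi cl; apply: nbi; first by rewrite -e;
        exact: Kbad.
      by apply/bad_sym; rewrite -e; exact: Kbad.
    exists ((upper F l (p i) - F (p i)) / 2); first by rewrite divr_gt0.
    by move=> e /andP[_ le] _; apply: le_lt_trans le _; lra.
  exists (Num.min d1 d2); first by rewrite lt_min d10.
  move=> e /andP[e0]; rewrite le_min => /andP[e1 e2]; split.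
    by move=> x Ox; exact: le_trans (h1 x Ox).
  by move=> i iN nb; apply: h2 => //; rewrite e0.
have {}hd := hd d; rewrite d0 lexx in hd; have {}hd := hd isT.
have low_class : [set G | tropical_series Omega G /\ range p `<=` corner_locus
  Omega G] (lowered K d).
  split; first by apply: lowered_tropical => // l lK; exact: (hd l lK).1.
  move=> _ [i _ <-]; have [gi _] := ht i.
  have [bi|nbi] := pselect (bad (t i).1).
    apply: lowered_corner_in gi _ _ => //;
      first exact: (Kmem i _ (or_introl erefl)).
    by apply: (Kmem i _ (or_intror erefl)); apply/(bad_sym i).1.
  have [_ _ am _ _] := gi; apply: lowered_corner_out am d0 _;
    first exact: marked_corner.
  by move=> l lK; apply: (hd l lK).2 => //; rewrite mem_enum.
(* At a point of [cell F m0], minimality gives [F u <= lowered K d u <= F u - d]. *)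
have [u mu] := im0.1; have [Ou au] := cell_contact mu.
have := relaxation_le low_class Ou; have := lowered_le_upper d u Km0.
rewrite -au; lra.
Qed.

Lemma marked_edges_connected f g : graph_face G0 f -> graph_face G0 g ->
  mg_walk dual marked_edges f g.
Proof.
have [ext [extf extO]] := exterior_face F W; move=> ff fg.
apply: mg_walk_trans (exterior_reaches extf extO fg).
by apply: mg_walk_sym (exterior_reaches extf extO ff); exact: face_sides_sym.
Qed.

End Tree.
End Domain.

Theorem lemma4p28 (R : realType) (Omega : set (R * R)) (N : nat)
    (p : 'I_N -> R * R) :
  rational_polygon Omega -> (0 < N)%N -> strongly_generic Omega p ->
  exists2 eps : R, 0 < eps &
    forall W : set (R * R), regular_truncation Omega p eps W ->
      let G0 := truncated_graph
                  (tropical_graph Omega (relaxation Omega (range p))) W in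
      let e := fun i : 'I_N => edge_through G0 (p i) in
      injective e /\ spanning_tree (planar_dual G0) (range e).
Proof.
move=> polyO N0 gen; exists 1 => // W.
move=> [k [q [[_ openW _ _ _] _ _ [pW nodesW] cross]]] G0 e.
pose i0 : 'I_N := Ordinal N0.
have crossW e' : leaving_edge
  (tropical_graph Omega (relaxation Omega (range p))) W e' ->
    exists x, e' `&` bd W = [set x].
  by move=> /cross[x [i [a [b [h _ _ _]]]]]; exists x.
have {}pW i : W (p i) by apply: pW; exists i.
split; first exact: marked_edge_inj.
have tF := generic_tropical polyO i0 gen.
split.
- move=> _ [i _ <-]; apply: graph_edge_truncated => //; first exact: marked_corner.
  exact: marked_not_vertex.
- by have [f [ff _]] := exterior_face polyO (relaxation Omega (range p)) W;
  exists f.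
- by move=> f g ff fg; apply: marked_edges_connected.
- by move=> n v ee; apply: marked_edges_acyclic.
Qed.
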